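(* Let $f\in\mathscr{B}^\infty_{c,T}$, where $c\in\mathbb{R}$ and $T\in\mathbb{R}^+$. Then, for $r\in\mathbb{R}^+$, $$r^cf(r,0)=\sin(T\log r)\left[\frac{(\widetilde{\Theta}_cf)(1,0)}{T}+\frac{f(1,0)}{T\log r}+T\log r\sum_{k\in\mathbb{Z}\setminus\{0\}}\frac{(-1)^{k+1}e^{k\pi c/T}f(e^{k\pi/T},0)}{k\pi(k\pi-T\log r)}\right],$$ where at the points $r=e^{k\pi/T}$ ($k\in\mathbb{Z}$) the quotients $\frac{\sin(T\log r)}{T\log r}$ and $\frac{\sin(T\log r)}{k\pi-T\log r}$ obtained by multiplying out are understood as their continuous extensions. The series (so understood, with the factor $\sin(T\log r)$ multiplied in) converges absolutely and uniformly on compact subsets of $\mathbb{R}^+$.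
   Context: $\mathbb{H}:=\{(r,\theta): r\in\mathbb{R}^+,\ \theta\in\mathbb{R}\}$ with $\mathbb{R}^+=(0,\infty)$. A function $f:\mathbb{H}\to\mathbb{C}$ is polar-analytic on $\mathbb{H}$ if for every $(r_0,\theta_0)\in\mathbb{H}$ the limit $$(D_{\rm pol}f)(r_0,\theta_0):=\lim_{(r,\theta)\to(r_0,\theta_0)}\frac{f(r,\theta)-f(r_0,\theta_0)}{re^{i\theta}-r_0e^{i\theta_0}}$$ exists. The polar Mellin derivative is $(\widetilde{\Theta}_cf)(r,\theta):=re^{i\theta}(D_{\rm pol}f)(r,\theta)+c f(r,\theta)$. The Mellin--Bernstein space $\mathscr{B}^\infty_{c,T}$ ($c\in\mathbb{R}$, $T>0$) consists of all $f:\mathbb{H}\to\mathbb{C}$ such that (i) $f$ is polar-analytic on $\mathbb{H}$; (ii) $f(\cdot,0)\in X_c^\infty$, i.e. $\sup_{r>0}r^c|f(r,0)|<\infty$; (iii) there is a constant $C_f>0$ with $r^c|f(r,\theta)|\le C_fe^{T|\theta|}$ for all $(r,\theta)\in\mathbb{H}$. *)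

(* Defs.v *)
From Stdlib Require Import Reals ZArith.
From Coquelicot Require Import Coquelicot.
Local Open Scope R_scope.

(* A function on H = (0,+oo) x R is a total function R -> R -> C of which only
   the values f r theta with 0 < r are ever used. *)

Definition polar (r theta : R) : C := (r * cos theta, r * sin theta).

Definition is_Dpol (f : R -> R -> C) (r0 theta0 : R) (l : C) : Prop :=
  filterlim
    (fun p : R * R =>
       ((f (fst p) (snd p) - f r0 theta0)
          / (polar (fst p) (snd p) - polar r0 theta0))%C)
    (locally' ((r0, theta0) : prod_UniformSpace R_UniformSpace R_UniformSpace))
    (locally l).

Definition polar_analytic (f : R -> R -> C) : Prop :=
  forall r0 theta0 : R, 0 < r0 -> exists l : C, is_Dpol f r0 theta0 l.

(* [iota] returns the limit when it exists, as the limit is then unique. *)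
Definition Dpol (f : R -> R -> C) (r theta : R) : C :=
  iota (T := C_CompleteNormedModule) (fun l : C => is_Dpol f r theta l).

Definition Mellin_Theta (c : R) (f : R -> R -> C) (r theta : R) : C :=
  (polar r theta * Dpol f r theta + RtoC c * f r theta)%C.

Definition X_infty (c : R) (h : R -> C) : Prop :=
  exists M : R, forall r : R, 0 < r -> Rpower r c * Cmod (h r) <= M.

Definition Mellin_Bernstein (c T : R) (f : R -> R -> C) : Prop :=
  polar_analytic f /\
  X_infty c (fun r => f r 0) /\
  exists Cf : R, 0 < Cf /\
    forall r theta : R, 0 < r ->
      Rpower r c * Cmod (f r theta) <= Cf * exp (T * Rabs theta).

(* Value at x of the continuous extension of q.  [Lim] is the limit over
   punctured neighbourhoods of x, so the (junk) value that q takes at x when a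
   denominator vanishes there plays no role; where q is continuous this is q x. *)
Definition cont_ext (q : R -> R) (x : R) : R := real (Lim q x).

(* Series over Z \ {0}: the two tails are cut off independently. *)
Definition Zstar_sum (t : Z -> C) (m n : nat) : C :=
  (sum_n (fun j => t (- Z.of_nat (S j))%Z) m
     + sum_n (fun j => t (Z.of_nat (S j))) n)%C.

Definition is_Zstar_series (t : Z -> C) (s : C) : Prop :=
  filterlim (fun p : nat * nat => Zstar_sum t (fst p) (snd p))
    (filter_prod eventually eventually) (locally s).

Definition Zstar_series (t : Z -> C) : C :=
  iota (T := C_CompleteNormedModule) (fun s : C => is_Zstar_series t s).

Definition Zstar_abs_convergent (t : Z -> C) : Prop :=
  ex_series (fun j => Cmod (t (- Z.of_nat (S j))%Z)) /\
  ex_series (fun j => Cmod (t (Z.of_nat (S j)))).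

Definition Zstar_converges_uniformly_on
    (K : R -> Prop) (t : R -> Z -> C) (s : R -> C) : Prop :=
  forall eps : posreal, exists N : nat, forall m n : nat,
    (N <= m)%nat -> (N <= n)%nat ->
    forall r : R, K r -> Cmod (Zstar_sum (t r) m n - s r)%C < eps.

(* k-th summand of the sampling series, with the factor sin (T log r) already
   multiplied in; the continuous extension is taken with respect to r. *)
Definition sampling_term (c T : R) (f : R -> R -> C) (r : R) (k : Z) : C :=
  (RtoC (powerRZ (-1) (k + 1) * exp (IZR k * PI * c / T))
     * f (exp (IZR k * PI / T)) 0 / RtoC (IZR k * PI)
     * RtoC (cont_ext
               (fun x => (sin (T * ln x) / (IZR k * PI - T * ln x))%R) r))%C.

(* Main.v *)
Require Import Defs.
From Stdlib Require Import Reals ZArith Lra Lia List ClassicalEpsilon FunctionalExtensionality.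
From Coquelicot Require Import Coquelicot.
Import ListNotations.
Local Open Scope R_scope.

(* With z = T (log r + i theta), the function G(z) = r^c e^{i c theta} f(r, theta)
   is entire, |G(x + i y)| <= C e^|y|, and G'(0) = (Theta_c f)(1, 0) / T.  For real
   u and v that are not multiples of pi, the residues of
   G(z) / ((z - u) (z - v) sin z) in the square |x|, |y| < (N + 1/2) pi add up to
   O(1/N), because |sin z| >= e^|y| / 4 on its boundary.  Letting first N tend to
   infinity and then v to 0 gives the expansion of G(u); at the multiples of pi
   only one term of the series survives.  Both modes of convergence follow from
   |sin(h) / h| <= min(1, 1 / |h|), which makes the k-th term O((1 + |u|) / k^2).
   All poles lie on the real axis, so Cauchy's theorem is needed only for
   functions that are continuous everywhere and differentiable off that axis. *)

(** * Continuity and complex derivative *)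

(** With the single node [u], the kernel G(z) / ((z - u) sin z) is only O(1/N) on a contour of
    length O(N), so its integral need not vanish in the limit; the second node supplies the missing
    power of N. Placing that node at 0 outright would create a double pole, whose residue is where
    G'(0) comes from. A generic [v] keeps every pole simple, and the confluence then needs only that
    G and sin z / z are differentiable at 0. Polar analyticity provides a derivative at each point
    but says nothing about its continuity, so Cauchy's theorem is proved in Goursat's form. Since
    theta runs over all of R without periodicity, log r + i theta is a global coordinate and no
    branch of the logarithm intervenes. The factor e^{i c theta} has modulus 1; it completes r^c to
    the entire function e^{c z / T}, whose derivative contributes the summand c f of the Mellin
    derivative. *)

Definition ccont (f : C -> C) (z : C) : Prop :=
  filterlim f (@locally C_UniformSpace z) (@locally C_UniformSpace (f z)).

(* Caratheodory's form of the derivative turns the rules of differentiation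
   into the algebra of continuous functions. *)
Definition cderiv (f : C -> C) (z l : C) : Prop :=
  exists phi : C -> C, ccont phi z /\ phi z = l /\
    @locally C_UniformSpace z (fun w => f w = f z + phi w * (w - z))%C.

Lemma locally_Cmod (z : C) (P : C -> Prop) :
  @locally C_UniformSpace z P <->
  exists d : R, 0 < d /\ forall w : C, Cmod (w - z) < d -> P w.
Proof.
  rewrite (locally_C z P); split.
  - intros [d Hd]; exists d; split; [apply cond_pos|]; intros w Hw; exact (Hd w Hw).
  - intros [d [Hd H]]; exists (mkposreal d Hd); intros w Hw; exact (H w Hw).
Qed.

Lemma ccontE (f : C -> C) (z : C) :
  ccont f z <-> forall eps : R, 0 < eps -> exists d : R, 0 < d /\
    forall w : C, Cmod (w - z) < d -> Cmod (f w - f z) < eps.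
Proof.
  split.
  - intros H eps He; apply (locally_Cmod z (fun w => Cmod (f w - f z) < eps)).
    apply (H (fun v => Cmod (v - f z) < eps)).
    apply locally_Cmod; exists eps; split; auto.
  - intros H P HP; destruct (proj1 (locally_Cmod _ _) HP) as [e [He HPe]].
    destruct (H e He) as [d [Hd Hw]].
    apply (locally_Cmod z (fun w => P (f w))); exists d; split; auto.
Qed.

(** [continuous_plus] and [continuous_mult] are used for [C] as a ring with absolute value, whereas
    [ccont] refers to the product of two real lines. By [locally_C] both structures have the same
    neighbourhoods. *)
Lemma ccont_ring (f : C -> C) (z : C) :
  @continuous (AbsRing_UniformSpace C_AbsRing) (AbsRing_UniformSpace C_AbsRing) f z <-> ccont f z.
Proof.
  split; intros H P HP.
  - apply (locally_C z (fun w => P (f w))); apply H; apply (locally_C (f z) P); exact HP.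
  - apply (locally_C z (fun w => P (f w))); apply H; apply (locally_C (f z) P); exact HP.
Qed.

Lemma ccont_const (k z : C) : ccont (fun _ => k) z.
Proof. apply filterlim_const. Qed.

Lemma ccont_id (z : C) : ccont (fun w => w) z.
Proof. apply filterlim_id. Qed.

Lemma ccont_plus (f g : C -> C) (z : C) :
  ccont f z -> ccont g z -> ccont (fun w => f w + g w)%C z.
Proof.
  intros Hf Hg; apply ccont_ring.
  apply (@continuous_plus (AbsRing_UniformSpace C_AbsRing) C_AbsRing
           (AbsRing_NormedModule C_AbsRing) f g z);
    apply ccont_ring; assumption.
Qed.

Lemma ccont_mult (f g : C -> C) (z : C) :
  ccont f z -> ccont g z -> ccont (fun w => f w * g w)%C z.
Proof.
  intros Hf Hg; apply ccont_ring.
  apply (@continuous_mult (AbsRing_UniformSpace C_AbsRing) C_AbsRing f g z);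
    apply ccont_ring; assumption.
Qed.

Lemma ccont_ext_loc (f g : C -> C) (z : C) :
  @locally C_UniformSpace z (fun w => f w = g w) -> ccont f z -> ccont g z.
Proof.
  intros H Hf; unfold ccont; rewrite <- (locally_singleton _ _ H).
  exact (filterlim_ext_loc f g H Hf).
Qed.

Lemma ccont_opp (f : C -> C) (z : C) : ccont f z -> ccont (fun w => - f w)%C z.
Proof.
  intros Hf; apply (ccont_ext_loc (fun w => RtoC (-1) * f w)%C).
  - apply filter_forall; intros w; unfold RtoC; apply injective_projections; simpl; ring.
  - apply ccont_mult; [apply ccont_const|exact Hf].
Qed.

Lemma ccont_minus (f g : C -> C) (z : C) :
  ccont f z -> ccont g z -> ccont (fun w => f w - g w)%C z.
Proof. intros Hf Hg; apply (ccont_plus f (fun w => - g w)%C); auto using ccont_opp. Qed.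

Lemma ccont_comp (f g : C -> C) (z : C) :
  ccont g z -> ccont f (g z) -> ccont (fun w => f (g w)) z.
Proof. intros Hg Hf; exact (filterlim_comp _ _ _ g f _ _ _ Hg Hf). Qed.

Lemma Cmod_minus_sym (x y : C) : Cmod (x - y) = Cmod (y - x).
Proof. rewrite <- Cmod_opp; f_equal; ring. Qed.

Lemma Cmod_minus_ge (x y : C) : Cmod x - Cmod y <= Cmod (x - y).
Proof.
  pose proof (Cmod_triangle (x - y) y) as H.
  replace (x - y + y)%C with x in H by ring; lra.
Qed.

Lemma Cmod_minus_le (x y : C) : Cmod (x - y) <= Cmod x + Cmod y.
Proof. unfold Cminus; rewrite <- (Cmod_opp y); apply Cmod_triangle. Qed.

Lemma ccont_nonzero (f : C -> C) (z : C) :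
  ccont f z -> f z <> 0%C -> @locally C_UniformSpace z (fun w => f w <> 0%C).
Proof.
  intros Hf H0; apply locally_Cmod.
  destruct (proj1 (ccontE f z) Hf (Cmod (f z))) as [d [Hd H]].
  { now apply Cmod_gt_0. }
  exists d; split; [exact Hd|]; intros w Hw E; specialize (H w Hw).
  rewrite E, Cmod_minus_sym in H; replace (f z - 0)%C with (f z) in H by ring; lra.
Qed.

Lemma ccont_inv (f : C -> C) (z : C) :
  ccont f z -> f z <> 0%C -> ccont (fun w => / f w)%C z.
Proof.
  intros Hf H0; apply (ccont_comp Cinv f z Hf); generalize (f z) H0; clear; intros a Ha.
  apply ccontE; intros eps He.
  assert (Hm : 0 < Cmod a) by now apply Cmod_gt_0.
  (* The first bound keeps |w| above |a| / 2, hence |w a| above |a|^2 / 2; the second then makes |a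
     - w| / |w a| smaller than [eps]. *)
  exists (Rmin (Cmod a / 2) (eps * (Cmod a * Cmod a) / 2)); split.
  { apply Rmin_pos; [lra|]; apply Rmult_lt_0_compat; [|lra].
    apply Rmult_lt_0_compat; [lra|]; now apply Rmult_lt_0_compat. }
  intros w Hw.
  assert (H1 : Cmod (w - a) < Cmod a / 2) by (eapply Rlt_le_trans; [exact Hw|apply Rmin_l]).
  assert (H2 : Cmod (w - a) < eps * (Cmod a * Cmod a) / 2)
    by (eapply Rlt_le_trans; [exact Hw|apply Rmin_r]).
  assert (H3 : Cmod a / 2 < Cmod w).
  { pose proof (Cmod_minus_ge a w) as H; rewrite Cmod_minus_sym in H; lra. }
  assert (Hw0 : w <> 0%C) by (apply Cmod_gt_0; lra).
  replace (/ w - / a)%C with ((a - w) / (w * a))%C by (field; auto).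
  rewrite Cmod_div by (apply Cmult_neq_0; auto).
  rewrite Cmod_mult, Cmod_minus_sym.
  apply Rlt_div_l; [apply Rmult_lt_0_compat; lra|].
  eapply Rlt_le_trans; [exact H2|].
  assert (H4 : Cmod a * Cmod a / 2 <= Cmod w * Cmod a) by nra; nra.
Qed.

Lemma ccont_div (f g : C -> C) (z : C) :
  ccont f z -> ccont g z -> g z <> 0%C -> ccont (fun w => f w / g w)%C z.
Proof. intros Hf Hg H0; apply ccont_mult; [|apply ccont_inv]; assumption. Qed.

Lemma cderiv_ccont (f : C -> C) (z l : C) : cderiv f z l -> ccont f z.
Proof.
  intros (phi & Hc & _ & He); apply (ccont_ext_loc (fun w => f z + phi w * (w - z))%C).
  - revert He; apply filter_imp; auto.
  - apply ccont_plus; [apply ccont_const|]; apply ccont_mult; [exact Hc|].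
    apply ccont_minus; [apply ccont_id|apply ccont_const].
Qed.

Lemma cderiv_ext_loc (f g : C -> C) (z l : C) :
  @locally C_UniformSpace z (fun w => f w = g w) -> cderiv f z l -> cderiv g z l.
Proof.
  intros H (phi & Hc & Hl & He); exists phi; split; [exact Hc|]; split; [exact Hl|].
  rewrite <- (locally_singleton _ _ H); generalize (filter_and _ _ H He).
  apply filter_imp; intros w [E1 E2]; congruence.
Qed.

Lemma cderiv_const (k z : C) : cderiv (fun _ => k) z 0%C.
Proof.
  exists (fun _ => 0%C); split; [apply ccont_const|]; split; [reflexivity|].
  apply locally_Cmod; exists 1; split; [lra|]; intros w _; ring.
Qed.

Lemma cderiv_id (z : C) : cderiv (fun w => w) z 1%C.
Proof.
  exists (fun _ => 1%C); split; [apply ccont_const|]; split; [reflexivity|].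
  apply locally_Cmod; exists 1; split; [lra|]; intros w _; ring.
Qed.

Lemma cderiv_plus (f g : C -> C) (z lf lg : C) :
  cderiv f z lf -> cderiv g z lg -> cderiv (fun w => f w + g w)%C z (lf + lg)%C.
Proof.
  intros (p & Pc & Pl & Pe) (q & Qc & Ql & Qe).
  exists (fun w => p w + q w)%C; split; [now apply ccont_plus|].
  split; [congruence|]; generalize (filter_and _ _ Pe Qe); apply filter_imp.
  intros w [-> ->]; ring.
Qed.

Lemma cderiv_mult (f g : C -> C) (z lf lg : C) :
  cderiv f z lf -> cderiv g z lg ->
  cderiv (fun w => f w * g w)%C z (lf * g z + f z * lg)%C.
Proof.
  intros Hf Hg; pose proof (cderiv_ccont _ _ _ Hg) as Gc.
  destruct Hf as (p & Pc & Pl & Pe); destruct Hg as (q & Qc & Ql & Qe).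
  exists (fun w => p w * g w + f z * q w)%C; split.
  { apply ccont_plus; apply ccont_mult; auto using ccont_const. }
  split; [congruence|]; generalize (filter_and _ _ Pe Qe); apply filter_imp.
  intros w [-> ->]; ring.
Qed.

Lemma cderiv_inv (f : C -> C) (z l : C) :
  cderiv f z l -> f z <> 0%C -> cderiv (fun w => / f w)%C z (- l / (f z * f z))%C.
Proof.
  intros Hf H0; pose proof (cderiv_ccont _ _ _ Hf) as Fc.
  destruct Hf as (p & Pc & Pl & Pe).
  exists (fun w => - p w / (f w * f z))%C; split.
  { apply ccont_div; [now apply ccont_opp|apply ccont_mult; auto using ccont_const|].
    now apply Cmult_neq_0. }
  split; [congruence|]; generalize (filter_and _ _ Pe (ccont_nonzero f z Fc H0)).
  apply filter_imp; intros w [E Hw].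
  transitivity (/ f z - (f w - f z) / (f w * f z))%C; [field; auto|].
  rewrite E at 1; field; auto.
Qed.

Lemma cderiv_comp (f g : C -> C) (z lf lg : C) :
  cderiv f (g z) lf -> cderiv g z lg -> cderiv (fun w => f (g w)) z (lf * lg)%C.
Proof.
  intros Hf Hg; pose proof (cderiv_ccont _ _ _ Hg) as Gc.
  destruct Hf as (p & Pc & Pl & Pe); destruct Hg as (q & Qc & Ql & Qe).
  exists (fun w => p (g w) * q w)%C; split.
  { apply ccont_mult; [now apply ccont_comp|exact Qc]. }
  split; [congruence|]; specialize (Gc _ Pe).
  change (@locally C_UniformSpace z
            (fun w => f (g w) = f (g z) + p (g w) * (g w - g z)))%C in Gc.
  generalize (filter_and _ _ Gc Qe); apply filter_imp; intros w [E1 E].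
  replace (p (g w) * q w * (w - z))%C with (p (g w) * (q w * (w - z)))%C by ring.
  replace (q w * (w - z))%C with (g w - g z)%C by (rewrite E at 1; ring).
  exact E1.
Qed.

(** * Integrals over the boundary of a rectangle *)

Definition hint (f : C -> C) (a b y : R) : C :=
  RInt (V := C_R_CompleteNormedModule) (fun x => f (x, y)) a b.

Definition vint (f : C -> C) (x c d : R) : C :=
  RInt (V := C_R_CompleteNormedModule) (fun y => f (x, y)) c d.

(** The counterclockwise contour integral: [hint] and [vint] integrate against dx and dy, and dz = i
    dy on the vertical sides. *)
Definition bdint (f : C -> C) (a b c d : R) : C :=
  (hint f a b c - hint f a b d + Ci * (vint f b c d - vint f a c d))%C.

Definition rect (a b c d : R) (z : C) : Prop :=
  a <= fst z <= b /\ c <= snd z <= d.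

Lemma Cmod_pair_le (x y : R) : Cmod (x, y) <= Rabs x + Rabs y.
Proof.
  replace (x, y) with (RtoC x + Ci * RtoC y)%C
    by (unfold RtoC, Ci; apply injective_projections; simpl; ring).
  eapply Rle_trans; [apply Cmod_triangle|].
  rewrite Cmod_mult, Cmod_Ci, !Cmod_R; lra.
Qed.

Lemma continuous_horizontal (f : C -> C) (x y : R) :
  ccont f (x, y) ->
  @continuous R_UniformSpace C_R_CompleteNormedModule (fun t => f (t, y)) x.
Proof.
  intros H P HP; specialize (H P HP); destruct (proj1 (locally_Cmod _ _) H) as [d [Hd Hw]].
  exists (mkposreal d Hd); intros t Ht; apply Hw.
  eapply Rle_lt_trans; [apply Cmod_pair_le|].
  simpl; replace (y + - y) with 0 by ring; rewrite Rabs_R0, Rplus_0_r; exact Ht.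
Qed.

Lemma continuous_vertical (f : C -> C) (x y : R) :
  ccont f (x, y) ->
  @continuous R_UniformSpace C_R_CompleteNormedModule (fun t => f (x, t)) y.
Proof.
  intros H P HP; specialize (H P HP); destruct (proj1 (locally_Cmod _ _) H) as [d [Hd Hw]].
  exists (mkposreal d Hd); intros t Ht; apply Hw.
  eapply Rle_lt_trans; [apply Cmod_pair_le|].
  simpl; replace (x + - x) with 0 by ring; rewrite Rabs_R0, Rplus_0_l; exact Ht.
Qed.

Definition hcont (f : C -> C) (a b y : R) : Prop :=
  forall x, a <= x <= b -> ccont f (x, y).

Definition vcont (f : C -> C) (x c d : R) : Prop :=
  forall y, c <= y <= d -> ccont f (x, y).

Lemma ex_hint (f : C -> C) (a b y : R) : a <= b -> hcont f a b y ->
  ex_RInt (V := C_R_CompleteNormedModule) (fun x => f (x, y)) a b.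
Proof.
  intros Hab H; apply (ex_RInt_continuous (V := C_R_CompleteNormedModule)).
  intros x; rewrite Rmin_left, Rmax_right by lra; intros Hx.
  now apply continuous_horizontal, H.
Qed.

Lemma ex_vint (f : C -> C) (x c d : R) : c <= d -> vcont f x c d ->
  ex_RInt (V := C_R_CompleteNormedModule) (fun y => f (x, y)) c d.
Proof.
  intros Hab H; apply (ex_RInt_continuous (V := C_R_CompleteNormedModule)).
  intros y; rewrite Rmin_left, Rmax_right by lra; intros Hy.
  now apply continuous_vertical, H.
Qed.

Lemma hint_Chasles (f : C -> C) (a b c y : R) : a <= b <= c -> hcont f a c y ->
  (hint f a b y + hint f b c y)%C = hint f a c y.
Proof.
  intros Hab H.
  apply (RInt_Chasles (V := C_R_CompleteNormedModule) (fun x => f (x, y)));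
    apply ex_hint; try lra; intros x Hx; apply H; lra.
Qed.

Lemma vint_Chasles (f : C -> C) (x a b c : R) : a <= b <= c -> vcont f x a c ->
  (vint f x a b + vint f x b c)%C = vint f x a c.
Proof.
  intros Hab H.
  apply (RInt_Chasles (V := C_R_CompleteNormedModule) (fun y => f (x, y)));
    apply ex_vint; try lra; intros y Hy; apply H; lra.
Qed.

Lemma hint_le (f : C -> C) (a b y M : R) : a <= b -> hcont f a b y ->
  (forall x, a <= x <= b -> Cmod (f (x, y)) <= M) -> Cmod (hint f a b y) <= (b - a) * M.
Proof.
  intros Hab H HM; rewrite Cmod_norm.
  apply (norm_RInt_le_const (V := C_R_CompleteNormedModule) (fun x => f (x, y)) a b _ M Hab).
  - intros x Hx; generalize (HM x Hx); rewrite Cmod_norm; exact (fun h => h).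
  - apply (RInt_correct (V := C_R_CompleteNormedModule)); now apply ex_hint.
Qed.

Lemma vint_le (f : C -> C) (x c d M : R) : c <= d -> vcont f x c d ->
  (forall y, c <= y <= d -> Cmod (f (x, y)) <= M) -> Cmod (vint f x c d) <= (d - c) * M.
Proof.
  intros Hab H HM; rewrite Cmod_norm.
  apply (norm_RInt_le_const (V := C_R_CompleteNormedModule) (fun y => f (x, y)) c d _ M Hab).
  - intros y Hy; generalize (HM y Hy); rewrite Cmod_norm; exact (fun h => h).
  - apply (RInt_correct (V := C_R_CompleteNormedModule)); now apply ex_vint.
Qed.

Lemma hint_minus (f g : C -> C) (a b y : R) : a <= b -> hcont f a b y -> hcont g a b y ->
  hint (fun z => f z - g z)%C a b y = (hint f a b y - hint g a b y)%C.
Proof.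
  intros Hab Hf Hg.
  exact (RInt_minus (V := C_R_CompleteNormedModule) _ _ a b
           (ex_hint f a b y Hab Hf) (ex_hint g a b y Hab Hg)).
Qed.

Lemma vint_minus (f g : C -> C) (x c d : R) : c <= d -> vcont f x c d -> vcont g x c d ->
  vint (fun z => f z - g z)%C x c d = (vint f x c d - vint g x c d)%C.
Proof.
  intros Hab Hf Hg.
  exact (RInt_minus (V := C_R_CompleteNormedModule) _ _ c d
           (ex_vint f x c d Hab Hf) (ex_vint g x c d Hab Hg)).
Qed.

(** Continuity on the four sides only, because the functions to be integrated may have poles inside
    the rectangle. *)
Definition bdcont (f : C -> C) (a b c d : R) : Prop :=
  (hcont f a b c /\ hcont f a b d) /\ vcont f a c d /\ vcont f b c d.

Lemma bdcont_rect (f : C -> C) (a b c d : R) : a <= b -> c <= d ->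
  (forall z, rect a b c d z -> ccont f z) -> bdcont f a b c d.
Proof.
  intros Hab Hcd H; repeat split; intros t Ht; apply H; split; simpl; lra.
Qed.

Lemma bdint_minus (f g : C -> C) (a b c d : R) : a <= b -> c <= d ->
  bdcont f a b c d -> bdcont g a b c d ->
  bdint (fun z => f z - g z)%C a b c d = (bdint f a b c d - bdint g a b c d)%C.
Proof.
  intros Hab Hcd [[F1 F2] [F3 F4]] [[G1 G2] [G3 G4]]; unfold bdint.
  rewrite !hint_minus, !vint_minus by assumption; ring.
Qed.

Lemma bdint_le (f : C -> C) (a b c d M : R) : a <= b -> c <= d ->
  bdcont f a b c d ->
  (forall z, rect a b c d z -> fst z = a \/ fst z = b \/ snd z = c \/ snd z = d ->
     Cmod (f z) <= M) ->
  Cmod (bdint f a b c d) <= 2 * ((b - a) + (d - c)) * M.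
Proof.
  intros Hab Hcd [[F1 F2] [F3 F4]] HM; unfold bdint.
  assert (H1 : Cmod (hint f a b c) <= (b - a) * M)
    by (apply hint_le; auto; intros; apply HM; [split; simpl; lra|simpl; auto]).
  assert (H2 : Cmod (hint f a b d) <= (b - a) * M)
    by (apply hint_le; auto; intros; apply HM; [split; simpl; lra|simpl; auto]).
  assert (H3 : Cmod (vint f a c d) <= (d - c) * M)
    by (apply vint_le; auto; intros; apply HM; [split; simpl; lra|simpl; auto]).
  assert (H4 : Cmod (vint f b c d) <= (d - c) * M)
    by (apply vint_le; auto; intros; apply HM; [split; simpl; lra|simpl; auto]).
  eapply Rle_trans; [apply Cmod_triangle|]; rewrite Cmod_mult, Cmod_Ci.
  pose proof (Cmod_minus_le (hint f a b c) (hint f a b d)).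
  pose proof (Cmod_minus_le (vint f b c d) (vint f a c d)); lra.
Qed.

Lemma bdint_split_h (f : C -> C) (a m b c d : R) : a <= m <= b -> c <= d ->
  (forall z, rect a b c d z -> ccont f z) ->
  bdint f a b c d = (bdint f a m c d + bdint f m b c d)%C.
Proof.
  intros Hm Hcd H; unfold bdint.
  rewrite <- (hint_Chasles f a m b c), <- (hint_Chasles f a m b d); try lra; [ring| |];
    intros t Ht; apply H; split; simpl; lra.
Qed.

Lemma bdint_split_v (f : C -> C) (a b c m d : R) : a <= b -> c <= m <= d ->
  (forall z, rect a b c d z -> ccont f z) ->
  bdint f a b c d = (bdint f a b c m + bdint f a b m d)%C.
Proof.
  intros Hab Hm H; unfold bdint.
  rewrite <- (vint_Chasles f a c m d), <- (vint_Chasles f b c m d); try lra; [ring| |];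
    intros t Ht; apply H; split; simpl; lra.
Qed.

(** The fundamental theorem of calculus, taken componentwise so that explicit antiderivatives can be
    checked by real differentiation. *)
Lemma is_RInt_C (F f : R -> C) (a b : R) : a <= b ->
  (forall t, a <= t <= b ->
     is_derive (fun s => fst (F s)) t (fst (f t)) /\
     is_derive (fun s => snd (F s)) t (snd (f t))) ->
  (forall t, a <= t <= b -> @continuous R_UniformSpace C_R_CompleteNormedModule f t) ->
  RInt (V := C_R_CompleteNormedModule) f a b = (F b - F a)%C.
Proof.
  intros Hab HF Hf; apply (is_RInt_unique (V := C_R_CompleteNormedModule)).
  replace (F b - F a)%C with (minus (fst (F b)) (fst (F a)), minus (snd (F b)) (snd (F a)))
    by reflexivity.
  apply (is_RInt_fct_extend_pair (U := R_NormedModule) (V := R_NormedModule)).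
  - apply (is_RInt_derive (fun s => fst (F s)));
      intros t; rewrite Rmin_left, Rmax_right by lra; intros Ht.
    + now apply HF.
    + apply (continuous_comp f fst); [now apply Hf|apply continuous_fst].
  - apply (is_RInt_derive (fun s => snd (F s)));
      intros t; rewrite Rmin_left, Rmax_right by lra; intros Ht.
    + now apply HF.
    + apply (continuous_comp f snd); [now apply Hf|apply continuous_snd].
Qed.

Lemma ccont_affine (k l z : C) : ccont (fun w => k + l * w)%C z.
Proof.
  apply ccont_plus; [apply ccont_const|]; apply ccont_mult; [apply ccont_const|apply ccont_id].
Qed.

Lemma hint_affine (k l : C) (a b y : R) : a <= b ->
  hint (fun z => k + l * z)%C a b y =
  ((k + l * (Ci * y)) * (b - a) + l * ((RtoC b * b - RtoC a * a) / 2))%C.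
Proof.
  intros Hab; unfold hint.
  rewrite (is_RInt_C (fun t => (k + l * (Ci * y)) * t + l * (RtoC t * t / 2))%C).
  - field.
  - exact Hab.
  - intros t Ht; unfold Ci, RtoC, Cdiv, Cinv; simpl; split; auto_derive; auto; simpl; field.
  - intros t Ht; apply (continuous_horizontal (fun z => k + l * z)%C), ccont_affine.
Qed.

Lemma vint_affine (k l : C) (x c d : R) : c <= d ->
  vint (fun z => k + l * z)%C x c d =
  ((k + l * x) * (d - c) + l * (Ci * ((RtoC d * d - RtoC c * c) / 2)))%C.
Proof.
  intros Hab; unfold vint.
  rewrite (is_RInt_C (fun t => (k + l * x) * t + l * (Ci * (RtoC t * t / 2)))%C).
  - field.
  - exact Hab.
  - intros t Ht; unfold Ci, RtoC, Cdiv, Cinv; simpl; split; auto_derive; auto; simpl; field.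
  - intros t Ht; apply (continuous_vertical (fun z => k + l * z)%C), ccont_affine.
Qed.

(** The case of Cauchy's theorem on which Goursat's argument rests: the first-order expansion of a
    function integrates to 0. *)
Lemma bdint_affine (k l : C) (a b c d : R) : a <= b -> c <= d ->
  bdint (fun z => k + l * z)%C a b c d = 0%C.
Proof.
  intros Hab Hcd; unfold bdint; rewrite !hint_affine, !vint_affine by assumption.
  unfold Ci, RtoC, Cdiv, Cinv; apply injective_projections; simpl; field.
Qed.

(** * Goursat's theorem *)

(** Every left end lies below every right end, so the supremum of the left ends belongs to all the
    intervals. *)
Lemma nested_limit (x : nat -> R) (s : nat -> R) :
  (forall n, x n <= x (S n)) -> (forall n, x (S n) + s (S n) <= x n + s n) ->
  (forall n, 0 <= s n) -> exists p, forall n, x n <= p <= x n + s n.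
Proof.
  intros Hx Hs Hp.
  assert (Mx : forall n m, (n <= m)%nat -> x n <= x m).
  { intros n m H; induction H; [lra|]; eapply Rle_trans; [exact IHle|apply Hx]. }
  assert (Ms : forall n m, (n <= m)%nat -> x m + s m <= x n + s n).
  { intros n m H; induction H; [lra|]; eapply Rle_trans; [apply Hs|exact IHle]. }
  assert (Hb : forall n m, x m <= x n + s n).
  { intros n m; destruct (Nat.le_ge_cases n m) as [H|H].
    - specialize (Ms n m H); specialize (Hp m); lra.
    - specialize (Mx m n H); specialize (Hp n); lra. }
  destruct (completeness (fun r => exists n, r = x n)) as [p [Hu Hl]].
  - exists (x 0%nat + s 0%nat); intros r [n ->]; apply Hb.
  - exists (x 0%nat); now exists 0%nat.
  - exists p; intros n; split.
    + apply Hu; now exists n.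
    + apply Hl; intros r [m ->]; apply Hb.
Qed.

(** Compactness by subdivision. A rectangle violating [Q] has a quarter violating it; the nested bad
    rectangles shrink to a point, where the local hypothesis is contradicted. The common scale [s]
    of both sides keeps the shape w : h fixed. *)
Lemma nested_bisection (Q : R -> R -> R -> Prop) (x0 y0 w h : R) :
  0 < w -> 0 < h ->
  (forall x y s, 0 < s -> x0 <= x -> x + s * w <= x0 + w ->
     y0 <= y -> y + s * h <= y0 + h ->
     Q x y (s / 2) -> Q (x + s / 2 * w) y (s / 2) -> Q x (y + s / 2 * h) (s / 2) ->
     Q (x + s / 2 * w) (y + s / 2 * h) (s / 2) -> Q x y s) ->
  (forall p q, x0 <= p <= x0 + w -> y0 <= q <= y0 + h ->
     exists d, 0 < d /\ forall x y s, 0 < s < d ->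
       x <= p <= x + s * w -> y <= q <= y + s * h ->
       x0 <= x -> x + s * w <= x0 + w -> y0 <= y -> y + s * h <= y0 + h -> Q x y s) ->
  Q x0 y0 1.
Proof.
  intros Hw Hh Hsub Hloc.
  destruct (classic (Q x0 y0 1)) as [|Hbad]; [assumption|exfalso].
  pose (good := fun (n : nat) (z : R * R) =>
    (x0 <= fst z /\ fst z + / 2 ^ n * w <= x0 + w) /\
    (y0 <= snd z /\ snd z + / 2 ^ n * h <= y0 + h) /\
    ~ Q (fst z) (snd z) (/ 2 ^ n)).
  assert (Hpos : forall n, 0 < / 2 ^ n) by (intros n; apply Rinv_0_lt_compat, pow_lt; lra).
  assert (Hhalf : forall n, / 2 ^ S n = / 2 ^ n / 2).
  { intros n; simpl; field; apply pow_nonzero; lra. }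
  assert (step : forall n z, good n z -> exists z', good (S n) z' /\
    (fst z <= fst z' /\ fst z' + / 2 ^ S n * w <= fst z + / 2 ^ n * w) /\
    (snd z <= snd z' /\ snd z' + / 2 ^ S n * h <= snd z + / 2 ^ n * h)).
  { intros n [x y] ((X1 & X2) & (Y1 & Y2) & HQ); cbn [fst snd] in X1, X2, Y1, Y2, HQ.
    unfold good; rewrite !Hhalf; specialize (Hpos n).
    set (s := / 2 ^ n) in *; clearbody s.
    assert (Pw : 0 < s * w) by now apply Rmult_lt_0_compat.
    assert (Ph : 0 < s * h) by now apply Rmult_lt_0_compat.
    apply NNPP; intros Hno; apply HQ; apply Hsub; try assumption;
      apply NNPP; intros Hq; apply Hno;
      [exists (x, y)|exists (x + s / 2 * w, y)
      |exists (x, y + s / 2 * h)|exists (x + s / 2 * w, y + s / 2 * h)];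
      cbn [fst snd]; repeat split; try assumption; lra. }
  pose (next := fun n (z : {z | good n z}) =>
    let e := constructive_indefinite_description _ (step n (proj1_sig z) (proj2_sig z)) in
    exist (good (S n)) (proj1_sig e) (proj1 (proj2_sig e))).
  assert (good0 : good 0%nat (x0, y0)).
  { unfold good; simpl; rewrite Rinv_1; repeat split; try lra; exact Hbad. }
  pose (sq := fix sq n : {z | good n z} :=
    match n with O => exist _ (x0, y0) good0 | S m => next m (sq m) end).
  assert (Hsq : forall n, let z := proj1_sig (sq n) in let z' := proj1_sig (sq (S n)) in
    (fst z <= fst z' /\ fst z' + / 2 ^ S n * w <= fst z + / 2 ^ n * w) /\
    (snd z <= snd z' /\ snd z' + / 2 ^ S n * h <= snd z + / 2 ^ n * h)).
  { intros n z z'.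
    exact (proj2 (proj2_sig (constructive_indefinite_description _
             (step n (proj1_sig (sq n)) (proj2_sig (sq n)))))). }
  destruct (nested_limit (fun n => fst (proj1_sig (sq n))) (fun n => / 2 ^ n * w)) as [p Hp].
  1, 2: intros n; apply Hsq.
  { intros n; specialize (Hpos n); apply Rlt_le; now apply Rmult_lt_0_compat. }
  destruct (nested_limit (fun n => snd (proj1_sig (sq n))) (fun n => / 2 ^ n * h)) as [q Hq].
  1, 2: intros n; apply Hsq.
  { intros n; specialize (Hpos n); apply Rlt_le; now apply Rmult_lt_0_compat. }
  destruct (Hloc p q) as [d [Hd HQ]].
  - specialize (Hp 0%nat); simpl in Hp; lra.
  - specialize (Hq 0%nat); simpl in Hq; lra.
  - destruct (pow_lt_1_zero (/ 2)) with (y := d) as [N HN].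
    + rewrite Rabs_pos_eq; lra.
    + exact Hd.
    + specialize (HN N (Nat.le_refl _)); rewrite pow_inv in HN.
      rewrite Rabs_pos_eq in HN by (apply Rlt_le, Hpos).
      destruct (proj2_sig (sq N)) as ((X1 & X2) & (Y1 & Y2) & Hn).
      apply Hn; apply HQ; auto.
Qed.

Lemma Cmod_le_rect (z p : C) (x y a b : R) :
  rect x (x + a) y (y + b) z -> rect x (x + a) y (y + b) p -> Cmod (z - p) <= a + b.
Proof.
  intros [Z1 Z2] [P1 P2]; destruct z as [z1 z2], p as [p1 p2]; simpl in *.
  eapply Rle_trans; [apply Cmod_pair_le|].
  apply Rplus_le_compat; apply Rabs_le; simpl; lra.
Qed.

(* Goursat: no continuity of the derivative is assumed. *)
Theorem Goursat (f : C -> C) (a b c d : R) : a < b -> c < d ->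
  (forall z, rect a b c d z -> exists l, cderiv f z l) -> bdint f a b c d = 0%C.
Proof.
  intros Hab Hcd Hf.
  assert (Hc : forall z, rect a b c d z -> ccont f z).
  { intros z Hz; destruct (Hf z Hz) as [l Hl]; now apply cderiv_ccont in Hl. }
  apply Cmod_eq_0; apply Rle_antisym; [|apply Cmod_ge_0].
  apply le_epsilon; intros eps Heps; rewrite Rplus_0_l.
  set (w := b - a); set (h := d - c).
  assert (Hw : 0 < w) by (unfold w; lra); assert (Hh : 0 < h) by (unfold h; lra).
  (* The tolerance is proportional to the area, so the bounds on four quarters, each eps (s/2)^2,
     add up to eps s^2. *)
  pose (Q := fun x y s : R =>
    Cmod (bdint f x (x + s * w) y (y + s * h)) <= eps * (s * s)).
  assert (H1 : Q a c 1).
  { apply (nested_bisection Q a c w h Hw Hh).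
    - unfold Q; intros x y s Hs X1 X2 Y1 Y2 Q1 Q2 Q3 Q4.
      assert (Pw : 0 < s * w) by now apply Rmult_lt_0_compat.
      assert (Ph : 0 < s * h) by now apply Rmult_lt_0_compat.
      assert (Hr : forall z, rect x (x + s * w) y (y + s * h) z -> ccont f z).
      { intros z [Z1 Z2]; apply Hc; unfold w, h in *; split; lra. }
      rewrite (bdint_split_h f x (x + s / 2 * w)); [|lra|lra|exact Hr].
      rewrite !(bdint_split_v f _ _ y (y + s / 2 * h) (y + s * h)); try lra;
        try (intros z [Z1 Z2]; apply Hr; split; lra).
      replace (x + s / 2 * w + s / 2 * w) with (x + s * w) in * by field.
      replace (y + s / 2 * h + s / 2 * h) with (y + s * h) in * by field.
      eapply Rle_trans; [apply Cmod_triangle|].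
      eapply Rle_trans; [apply Rplus_le_compat; apply Cmod_triangle|]; lra.
    - intros p q Hp Hq.
      destruct (Hf (p, q)) as [l (phi & Pc & Pl & Pe)].
      { unfold w, h in *; split; simpl; lra. }
      (* At scale s the perimeter is 2 s (w + h), and on it the error of the expansion is at most
         eta s (w + h); the product of the two is eps s^2. *)
      set (eta := eps / (2 * ((w + h) * (w + h)))).
      assert (Hwh : 0 < (w + h) * (w + h)) by nra.
      assert (Heta : 0 < eta) by (apply Rdiv_lt_0_compat; lra).
      destruct (proj1 (ccontE _ _) Pc eta Heta) as [d1 [Hd1 K1]].
      destruct (proj1 (locally_Cmod _ _) Pe) as [d2 [Hd2 K2]].
      (* Points of the small rectangle are within s (w + h) of (p, q), by [Cmod_le_rect]. *)
      exists (Rmin d1 d2 / (w + h)); split.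
      { apply Rdiv_lt_0_compat; [now apply Rmin_pos|lra]. }
      intros x y s [Hs Hsd] Hx Hy X1 X2 Y1 Y2; unfold Q.
      assert (Pw : 0 < s * w) by now apply Rmult_lt_0_compat.
      assert (Ph : 0 < s * h) by now apply Rmult_lt_0_compat.
      assert (Hr : forall z, rect x (x + s * w) y (y + s * h) z -> ccont f z).
      { intros z [Z1 Z2]; apply Hc; unfold w, h in *; split; lra. }
      (* Subtracting the first-order expansion leaves the integral unchanged, and the remainder is
         (phi z - phi (p, q)) (z - (p, q)). *)
      pose (lin := fun z => ((f (p, q) - l * (p, q)) + l * z)%C).
      assert (Hlin : forall z, ccont lin z) by (intros z; apply ccont_affine).
      replace (bdint f x (x + s * w) y (y + s * h))
        with (bdint (fun z => f z - lin z)%C x (x + s * w) y (y + s * h)).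
      2:{ rewrite bdint_minus; try lra; try (apply bdcont_rect; auto; lra).
          unfold lin at 1; rewrite bdint_affine by lra; ring. }
      apply Rmult_lt_compat_r with (r := w + h) in Hsd; [|lra].
      replace (Rmin d1 d2 / (w + h) * (w + h)) with (Rmin d1 d2) in Hsd by (field; lra).
      pose proof (Rmin_l d1 d2); pose proof (Rmin_r d1 d2).
      eapply Rle_trans.
      { apply bdint_le with (M := eta * (s * (w + h))); try lra.
        - apply bdcont_rect; try lra; intros z Hz; apply ccont_minus; auto.
        - intros z Hz _.
          assert (Hm : Cmod (z - (p, q)) <= s * w + s * h).
          { apply (Cmod_le_rect z (p, q) x y); [exact Hz|split; simpl; lra]. }
          rewrite K2 by lra.
          replace (f (p, q) + phi z * (z - (p, q)) - lin z)%C
            with ((phi z - phi (p, q)) * (z - (p, q)))%C by (unfold lin; rewrite Pl; ring).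
          rewrite Cmod_mult; apply Rmult_le_compat; try apply Cmod_ge_0; [|lra].
          apply Rlt_le, K1; lra. }
      apply Req_le; unfold eta; field; lra. }
  unfold Q in H1; replace (a + 1 * w) with b in H1 by (unfold w; ring).
  replace (c + 1 * h) with d in H1 by (unfold h; ring); lra.
Qed.

(** Heine's theorem for the real and the imaginary part, each with tolerance eps / 2. *)
Lemma uniform_ccont (f : C -> C) (a b c d eps : R) : 0 < eps ->
  (forall z, rect a b c d z -> ccont f z) ->
  exists delta, 0 < delta /\ forall z w, rect a b c d z -> rect a b c d w ->
    Cmod (z - w) < delta -> Cmod (f z - f w) < eps.
Proof.
  intros He Hf.
  assert (Hpt : forall x y, a <= x <= b -> c <= y <= d ->
    continuity_2d_pt (fun u v => fst (f (u, v))) x y /\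
    continuity_2d_pt (fun u v => snd (f (u, v))) x y).
  { intros x y Hx Hy.
    assert (H : forall e : posreal, locally_2d (fun u v => Cmod (f (u, v) - f (x, y)) < e) x y).
    { intros e; destruct (proj1 (ccontE f (x, y)) (Hf (x, y) (conj Hx Hy)) e (cond_pos e))
        as [t [Ht H]].
      assert (Ht2 : 0 < t / 2) by lra; exists (mkposreal _ Ht2); simpl.
      intros u v Hu Hv; apply H; eapply Rle_lt_trans; [apply Cmod_pair_le|]; simpl.
      unfold Rminus in Hu, Hv; lra. }
    split; intros e; specialize (H e); revert H; apply locally_2d_impl, locally_2d_forall;
      intros u v H; eapply Rle_lt_trans; try exact H;
      (eapply Rle_trans; [|apply Rmax_Cmod]); [apply Rmax_l|apply Rmax_r]. }
  assert (He2 : 0 < eps / 2) by lra.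
  destruct (uniform_continuity_2d _ a b c d (fun x y Hx Hy => proj1 (Hpt x y Hx Hy))
              (mkposreal _ He2)) as [d1 K1].
  destruct (uniform_continuity_2d _ a b c d (fun x y Hx Hy => proj2 (Hpt x y Hx Hy))
              (mkposreal _ He2)) as [d2 K2].
  pose proof (cond_pos d1); pose proof (cond_pos d2).
  exists (Rmin d1 d2); split; [now apply Rmin_pos|].
  intros [x y] [u v] [Z1 Z2] [W1 W2] Hd; simpl in *.
  pose proof (Rmin_l d1 d2); pose proof (Rmin_r d1 d2).
  pose proof (Rmax_Cmod ((x, y) - (u, v))%C) as Hm; simpl in Hm.
  pose proof (Rmax_l (Rabs (x + - u)) (Rabs (y + - v))).
  pose proof (Rmax_r (Rabs (x + - u)) (Rabs (y + - v))).
  specialize (K1 u v x y W1 W2 Z1 Z2); specialize (K2 u v x y W1 W2 Z1 Z2).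
  unfold Rminus in K1, K2.
  specialize (K1 ltac:(lra) ltac:(lra)); specialize (K2 ltac:(lra) ltac:(lra)).
  eapply Rle_lt_trans; [rewrite (surjective_pairing (f (x, y) - f (u, v))%C); apply Cmod_pair_le|].
  simpl; lra.
Qed.

Lemma ccont_shift (f : C -> C) (k z : C) :
  ccont f (z + k)%C -> ccont (fun w => f (w + k)%C) z.
Proof.
  intros H; apply (ccont_comp f (fun w => w + k)%C); [|exact H].
  apply ccont_plus; [apply ccont_id|apply ccont_const].
Qed.

(* The strip |y| <= e around the real axis contributes arbitrarily little, by
   uniform continuity; Goursat's theorem applies to the two remaining parts. *)
Lemma Cauchy_off_real_line (f : C -> C) (a b M : R) : a < b -> 0 < M ->
  (forall z, rect a b (- M) M z -> ccont f z) ->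
  (forall z, rect a b (- M) M z -> snd z <> 0 -> exists l, cderiv f z l) ->
  bdint f a b (- M) M = 0%C.
Proof.
  intros Hab HM Hc Hd.
  apply Cmod_eq_0; apply Rle_antisym; [|apply Cmod_ge_0].
  apply le_epsilon; intros eps He; rewrite Rplus_0_l.
  assert (Hba : 0 < b - a) by lra.
  destruct (uniform_ccont f a b (- M) M (eps / 2 / (b - a))) as [d1 [Hd1 K1]].
  { apply Rdiv_lt_0_compat; lra. }
  { exact Hc. }
  set (B := Cmod (f (a, 0)) + Cmod (f (b, 0)) + 1).
  assert (HB : 0 < B) by (pose proof (Cmod_ge_0 (f (a, 0))); pose proof (Cmod_ge_0 (f (b, 0)));
    unfold B; lra).
  destruct (uniform_ccont f a b (- M) M 1 Rlt_0_1 Hc) as [d2 [Hd2 K2]].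
  (* M / 2 keeps the strip inside the rectangle. With d1 / 4 its long sides, 2 e apart, carry values
     differing by less than eps / 2 / (b - a). With d2 / 2 the values on the short sides stay within
     1 of those at (a, 0) and (b, 0), hence below B. Finally the two short sides, of length 2 e,
     contribute at most 4 e B <= eps / 2. *)
  set (e := Rmin (Rmin (M / 2) (d1 / 4)) (Rmin (d2 / 2) (eps / (8 * B)))).
  assert (Heps : 0 < eps / (8 * B)) by (apply Rdiv_lt_0_compat; lra).
  assert (He0 : 0 < e) by (unfold e; repeat apply Rmin_pos; lra).
  assert (Hes : (e <= M / 2 /\ e <= d1 / 4) /\ e <= d2 / 2 /\ e <= eps / (8 * B)).
  { unfold e, Rmin; repeat destruct Rle_dec; lra. }
  clearbody e; destruct Hes as [[E1 E2] [E3 E4]].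
  assert (Hr : forall c d, - M <= c -> d <= M -> forall z, rect a b c d z -> ccont f z).
  { intros c d H1 H2 z [Z1 Z2]; apply Hc; split; lra. }
  rewrite (bdint_split_v f a b (- M) (- e) M); [|lra|lra|apply Hr; lra].
  rewrite (bdint_split_v f a b (- e) e M); [|lra|lra|apply Hr; lra].
  rewrite (Goursat f a b (- M) (- e)), (Goursat f a b e M); try lra;
    try (intros z [Z1 Z2]; apply Hd; [split; lra|lra]).
  replace (0 + (bdint f a b (- e) e + 0))%C with (bdint f a b (- e) e) by ring.
  unfold bdint.
  assert (Hside : forall x, a <= x <= b -> Cmod (f (x, 0)) <= B - 1 ->
    Cmod (vint f x (- e) e) <= (e - - e) * B).
  { intros x Hx HxB; apply vint_le; [lra| |].
    - intros y Hy; apply Hc; split; simpl; lra.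
    - intros y Hy.
      assert (H : Cmod (f (x, y) - f (x, 0)) < 1).
      { apply K2; try (split; simpl; lra).
        eapply Rle_lt_trans; [apply Cmod_pair_le|]; simpl.
        replace (x + - x) with 0 by ring; rewrite Rabs_R0, Rplus_0_l.
        apply Rle_lt_trans with e; [apply Rabs_le|]; lra. }
      pose proof (Cmod_minus_ge (f (x, y)) (f (x, 0))); lra. }
  assert (Hh : Cmod (hint f a b (- e) - hint f a b e) <= (b - a) * (eps / 2 / (b - a))).
  (* Translating the upper side by -2 i e turns the difference of two integrals into one integral of
     a pointwise small difference. *)
  { replace (hint f a b (- e) - hint f a b e)%C
      with (hint (fun z => f z - f (z + (0, (2 * e)%R)))%C a b (- e)).
    - apply hint_le; [lra| |].
      + intros x Hx; apply ccont_minus; [apply Hc; split; simpl; lra|].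
        apply ccont_shift.
        apply Hc; split; simpl; lra.
      + intros x Hx; apply Rlt_le, K1; try (split; simpl; lra).
        eapply Rle_lt_trans; [apply Cmod_pair_le|]; simpl.
        replace (x + - (x + 0)) with 0 by ring; rewrite Rabs_R0, Rplus_0_l.
        apply Rle_lt_trans with (2 * e); [apply Rabs_le|]; lra.
    - rewrite (hint_minus f (fun z => f (z + (0, (2 * e)%R))%C)); [|lra| |].
      + apply (f_equal (Cminus _)); unfold hint.
        apply (RInt_ext (V := C_R_CompleteNormedModule)); intros x _.
        f_equal; apply injective_projections; simpl; ring.
      + intros x Hx; apply Hc; split; simpl; lra.
      + intros x Hx; apply ccont_shift.
        apply Hc; split; simpl; lra. }
  replace ((b - a) * (eps / 2 / (b - a))) with (eps / 2) in Hh by (field; lra).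
  eapply Rle_trans; [apply Cmod_triangle|]; rewrite Cmod_mult, Cmod_Ci.
  pose proof (Cmod_minus_le (vint f b (- e) e) (vint f a (- e) e)) as Hv.
  pose proof (Cmod_ge_0 (f (a, 0))); pose proof (Cmod_ge_0 (f (b, 0))).
  pose proof (Hside a ltac:(lra) ltac:(unfold B; lra)).
  pose proof (Hside b ltac:(lra) ltac:(unfold B; lra)).
  apply Rmult_le_compat_r with (r := 8 * B) in E4; [|lra].
  replace (eps / (8 * B) * (8 * B)) with eps in E4 by (field; lra); lra.
Qed.

(** * Residues at real poles *)

Lemma ccont_pole (r a z : C) : z <> a -> ccont (fun w => r / (w - a))%C z.
Proof.
  intros H; apply ccont_div; [apply ccont_const| |].
  - apply ccont_minus; [apply ccont_id|apply ccont_const].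
  - intros E; apply H; replace z with (z - a + a)%C by ring; rewrite E; ring.
Qed.

(** The antiderivative is r log (z - p) up to a constant. Its argument is expressed by the
    arctangent of (x - p) / y here, and of y / (x - p) on vertical sides: each ratio is defined
    along the whole side, so no branch has to be chosen. *)
Lemma hint_pole (r : C) (p a b y : R) : a <= b -> y <> 0 ->
  hint (fun z => r / (z - p))%C a b y =
  (r * ((/ 2 * ln ((b - p) * (b - p) + y * y) - / 2 * ln ((a - p) * (a - p) + y * y))%R,
        (atan ((a - p) / y) - atan ((b - p) / y))%R))%C.
Proof.
  intros Hab Hy; unfold hint.
  assert (Hp : forall x, 0 < (x - p) * (x - p) + y * y).
  { intros x; assert (0 < y * y) by (apply Rsqr_pos_lt; exact Hy); 
    pose proof (Rle_0_sqr (x - p)) as Hs; unfold Rsqr in Hs; lra. }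
  rewrite (is_RInt_C (fun x => r * ((/ 2 * ln ((x - p) * (x - p) + y * y))%R,
                                    (- atan ((x - p) / y))%R))%C).
  - apply injective_projections; simpl; ring.
  - exact Hab.
  - intros x Hx; specialize (Hp x); destruct r as [r1 r2].
    unfold RtoC, Cdiv, Cinv; simpl; split; auto_derive; auto; simpl;
      unfold Rsqr; field; repeat split; auto; try lra; nra.
  - intros x Hx; apply (continuous_horizontal (fun z => r / (z - p))%C), ccont_pole.
    intros E; apply Hy; exact (f_equal snd E).
Qed.

Lemma vint_pole (r : C) (p x c d : R) : c <= d -> x <> p ->
  vint (fun z => r / (z - p))%C x c d =
  (r * ((atan (d / (x - p)) - atan (c / (x - p)))%R,
        (/ 2 * ln ((x - p) * (x - p) + c * c) - / 2 * ln ((x - p) * (x - p) + d * d))%R))%C.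
Proof.
  intros Hab Hx; unfold vint.
  assert (Hxp : x - p <> 0) by lra.
  assert (Hp : forall y, 0 < (x - p) * (x - p) + y * y).
  { intros y; assert (0 < (x - p) * (x - p)) by (apply Rsqr_pos_lt; exact Hxp).
    pose proof (Rle_0_sqr y) as Hs; unfold Rsqr in Hs; lra. }
  rewrite (is_RInt_C (fun y => r * ((atan (y / (x - p)))%R,
                                    (- / 2 * ln ((x - p) * (x - p) + y * y))%R))%C).
  - apply injective_projections; simpl; ring.
  - exact Hab.
  - intros y Hy; specialize (Hp y); destruct r as [r1 r2].
    unfold RtoC, Cdiv, Cinv; simpl; split; auto_derive; auto; simpl;
      unfold Rsqr; field; repeat split; auto; try lra; nra.
  - intros y Hy; apply (continuous_vertical (fun z => r / (z - p))%C), ccont_pole.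
    intros E; apply Hx; exact (f_equal fst E).
Qed.

(** The logarithms cancel because the rectangle is symmetric about the real axis; the arctangents
    combine through atan t + atan (1/t) = PI / 2 for t > 0 into the full angle 2 PI. *)
Lemma bdint_pole (r : C) (p a b M : R) : a < p < b -> 0 < M ->
  bdint (fun z => r / (z - p))%C a b (- M) M = (2 * PI * Ci * r)%C.
Proof.
  intros Hp HM; unfold bdint; rewrite !hint_pole, !vint_pole by lra.
  assert (E1 : atan (M / (b - p)) = PI / 2 - atan ((b - p) / M)).
  { rewrite <- atan_inv by (apply Rdiv_lt_0_compat; lra); f_equal; field; lra. }
  assert (E2 : atan (M / (a - p)) = - (PI / 2) - atan ((a - p) / M)).
  { replace (M / (a - p)) with (- / ((p - a) / M)) by (field; lra).
    rewrite atan_opp, atan_inv by (apply Rdiv_lt_0_compat; lra).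
    replace ((a - p) / M) with (- ((p - a) / M)) by (field; lra); rewrite atan_opp; ring. }
  replace (- M / (b - p)) with (- (M / (b - p))) by (field; lra).
  replace (- M / (a - p)) with (- (M / (a - p))) by (field; lra).
  replace ((a - p) / - M) with (- ((a - p) / M)) by (field; lra).
  replace ((b - p) / - M) with (- ((b - p) / M)) by (field; lra).
  replace (- M * - M) with (M * M) by ring.
  rewrite !atan_opp, E1, E2; destruct r as [r1 r2].
  unfold Ci, RtoC; apply injective_projections; simpl; field.
Qed.

Lemma bdint_ext (f g : C -> C) (a b c d : R) : a <= b -> c <= d ->
  (forall x, a <= x <= b -> f (x, c) = g (x, c) /\ f (x, d) = g (x, d)) ->
  (forall y, c <= y <= d -> f (a, y) = g (a, y) /\ f (b, y) = g (b, y)) ->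
  bdint f a b c d = bdint g a b c d.
Proof.
  intros Hab Hcd H1 H2.
  assert (Eh : forall y, (y = c \/ y = d) -> hint f a b y = hint g a b y).
  { intros y Hy; apply (RInt_ext (V := C_R_CompleteNormedModule)).
    intros x; rewrite Rmin_left, Rmax_right by lra; intros Hx.
    destruct Hy as [-> | ->]; apply H1; lra. }
  assert (Ev : forall x, (x = a \/ x = b) -> vint f x c d = vint g x c d).
  { intros x Hx; apply (RInt_ext (V := C_R_CompleteNormedModule)).
    intros y; rewrite Rmin_left, Rmax_right by lra; intros Hy.
    destruct Hx as [-> | ->]; apply H2; lra. }
  unfold bdint; rewrite !Eh, !Ev; auto.
Qed.

(** * Simple poles and the sum of their residues *)

Definition csum (l : list C) : C := fold_right Cplus (RtoC 0) l.

(** The regular part [g] is only asked to be continuous at the pole, which is what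
    [Cauchy_off_real_line] requires on the real axis. *)
Definition simple_pole (K : C -> C) (a r : C) : Prop :=
  exists g, ccont g a /\
    @locally C_UniformSpace a (fun w => w <> a -> K w = r / (w - a) + g w)%C.

Lemma locally_neq (z a : C) : z <> a -> @locally C_UniformSpace z (fun w => w <> a).
Proof.
  intros H; assert (Hs : @locally C_UniformSpace z (fun w => (w - a)%C <> 0%C)).
  { apply (ccont_nonzero (fun w => (w - a)%C)).
    - apply ccont_minus; [apply ccont_id|apply ccont_const].
    - intros E; apply H; replace z with (z - a + a)%C by ring; rewrite E; ring. }
  revert Hs; apply filter_imp; intros w Hw ->; apply Hw; ring.
Qed.

Lemma cderiv_pole (r a z : C) : z <> a -> exists l, cderiv (fun w => r / (w - a))%C z l.
Proof.
  intros H; eexists; apply cderiv_mult; [apply cderiv_const|].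
  apply (cderiv_inv (fun w => w + - a)%C).
  - apply cderiv_plus; [apply cderiv_id|apply cderiv_const].
  - intros E; apply H; replace z with (z + - a + a)%C by ring; rewrite E; ring.
Qed.

(* Each pole is removed by subtracting its principal part; what remains in the
   end is continuous, so that [Cauchy_off_real_line] applies. *)
Theorem residue_theorem_real_poles (poles : list (R * C)) (K : C -> C) (a b M : R) :
  a < b -> 0 < M -> NoDup (map fst poles) ->
  (forall z, rect a b (- M) M z -> snd z <> 0 -> exists l, cderiv K z l) ->
  (forall x, a <= x <= b -> ~ In x (map fst poles) -> ccont K (x, 0)) ->
  (forall p r, In (p, r) poles -> a < p < b /\ simple_pole K (RtoC p) r) ->
  bdint K a b (- M) M = (2 * PI * Ci * csum (map snd poles))%C.
Proof.
  intros Hab HM; revert K; induction poles as [|[p r] poles IH]; intros K Hnd Hd Hc Hp.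
  - simpl; rewrite Cauchy_off_real_line; try assumption; [ring|].
    intros [x y] Hz; destruct (Req_dec y 0) as [->|Hy].
    + apply Hc; [apply Hz|intros []].
    + destruct (Hd (x, y) Hz Hy) as [l Hl]; now apply cderiv_ccont in Hl.
  - inversion Hnd as [|? ? Hnotin Hnd']; subst; simpl in Hnotin.
    destruct (Hp p r (or_introl eq_refl)) as [Hpab (g & Hg & Hgl)].
    (* The value [g p] fills the removable singularity left after subtracting the principal part, so
       [K1] is continuous at [p] and keeps only the remaining poles. *)
    pose (K1 := fun w => if Ceq_dec w (RtoC p) then g (RtoC p) else (K w - r / (w - RtoC p))%C).
    assert (K1off : forall z, z <> RtoC p ->
      @locally C_UniformSpace z (fun w => (K w - r / (w - RtoC p))%C = K1 w)).
    { intros z Hz; generalize (locally_neq z (RtoC p) Hz); apply filter_imp; intros w Hw.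
      unfold K1; destruct (Ceq_dec w (RtoC p)); [contradiction|reflexivity]. }
    assert (K1cont : forall z, z <> RtoC p -> ccont K z -> ccont K1 z).
    { intros z Hz HK; apply (ccont_ext_loc _ _ _ (K1off z Hz)).
      apply ccont_minus; [exact HK|now apply ccont_pole]. }
    assert (HKb : bdcont K a b (- M) M).
    { assert (HKy : forall x y, a <= x <= b -> - M <= y <= M -> y <> 0 -> ccont K (x, y)).
      { intros x y Hx Hy H0; destruct (Hd (x, y)) as [l Hl]; [split; assumption|exact H0|].
        now apply cderiv_ccont in Hl. }
      assert (HKx : forall x y, x = a \/ x = b -> - M <= y <= M -> ccont K (x, y)).
      { intros x y Hx Hy; destruct (Req_dec y 0) as [->|H0].
        - apply Hc; [destruct Hx; lra|].
          intros Hin; apply in_map_iff in Hin; destruct Hin as [[q s] [E Hin]]; simpl in E.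
          destruct (Hp q s Hin) as [Hq _]; destruct Hx; lra.
        - apply HKy; try assumption; destruct Hx; lra. }
      split; split; intros t Ht; try (apply HKy; lra); apply HKx; auto. }
    assert (Hneq : forall x y, x = a \/ x = b \/ y = - M \/ y = M -> (x, y) <> RtoC p).
    { intros x y Hxy E; injection E; lra. }
    assert (E : bdint K1 a b (- M) M =
      (bdint K a b (- M) M - bdint (fun z => r / (z - RtoC p))%C a b (- M) M)%C).
    { rewrite <- bdint_minus; try lra; [|exact HKb|].
      - assert (Hoff : forall x y, (x, y) <> RtoC p ->
          K1 (x, y) = (K (x, y) - r / ((x, y) - RtoC p))%C).
        { intros x y Hxy; symmetry; exact (locally_singleton _ _ (K1off _ Hxy)). }
        apply bdint_ext; try lra; intros t Ht; split; apply Hoff, Hneq; auto.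
      - split; split; intros t Ht; apply ccont_pole, Hneq; auto. }
    rewrite bdint_pole in E by assumption.
    rewrite IH in E; try assumption.
    + change (map snd ((p, r) :: poles)) with (r :: map snd poles); simpl csum.
      replace (bdint K a b (- M) M) with
        (bdint K a b (- M) M - 2 * PI * Ci * r + 2 * PI * Ci * r)%C by ring.
      rewrite <- E; ring.
    + intros z Hz Hz0; destruct (Hd z Hz Hz0) as [l Hl].
      assert (Hzp : z <> RtoC p) by (intros ->; now apply Hz0).
      destruct (cderiv_pole (- r) (RtoC p) z Hzp) as [l' Hl'].
      exists (l + l')%C; apply (cderiv_ext_loc (fun w => K w + - r / (w - RtoC p))%C).
      * generalize (K1off z Hzp); apply filter_imp; intros w <-; unfold Cdiv; ring.
      * now apply cderiv_plus.
    + intros x Hx Hin; destruct (Req_dec x p) as [->|Hxp].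
      * apply (ccont_ext_loc g); [|exact Hg].
        revert Hgl; apply filter_imp; intros w Hw; unfold K1.
        change (RtoC p) with (p, 0) in *.
        destruct (Ceq_dec w (p, 0)) as [->|Hne]; [reflexivity|].
        rewrite Hw by assumption; ring.
      * apply K1cont; [intros E'; injection E'; lra|].
        apply Hc; [exact Hx|]; intros [E'|Hin']; [simpl in E'; congruence|contradiction].
    + intros q s Hin; destruct (Hp q s (or_intror Hin)) as [Hq (h & Hh & Hhl)].
      split; [exact Hq|].
      assert (Hqp : RtoC q <> RtoC p).
      { intros E'; apply RtoC_inj in E'; subst q; apply Hnotin.
        change p with (fst (p, s)); now apply in_map. }
      exists (fun w => h w - r / (w - RtoC p))%C; split.
      * apply ccont_minus; [exact Hh|now apply ccont_pole].
      * generalize (filter_and _ _ Hhl (K1off _ Hqp)); apply filter_imp.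
        intros w [H1 H2] Hw; rewrite <- H2, H1 by exact Hw; ring.
Qed.

(** * Exponential and sine *)

(** The difference quotient, completed by [l] at [z], serves as the Caratheodory function. *)
Lemma cderiv_intro (f : C -> C) (z l : C) :
  (forall eps, 0 < eps -> exists d, 0 < d /\ forall w, Cmod (w - z) < d ->
     Cmod (f w - f z - l * (w - z)) <= eps * Cmod (w - z)) ->
  cderiv f z l.
Proof.
  intros H.
  exists (fun w => if Ceq_dec w z then l else ((f w - f z) / (w - z))%C).
  split; [|split].
  - apply ccontE; intros eps He; destruct (H (eps / 2)) as [d [Hd Hw]]; [lra|].
    exists d; split; [exact Hd|]; intros w Hwd; specialize (Hw w Hwd).
    destruct (Ceq_dec z z) as [_|n]; [|contradiction].
    destruct (Ceq_dec w z) as [->|Hn].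
    + replace (l - l)%C with (RtoC 0) by ring; rewrite Cmod_0; exact He.
    + assert (Hwz : (w - z)%C <> 0%C).
      { intros E; apply Hn; replace w with (w - z + z)%C by ring; rewrite E; ring. }
      replace ((f w - f z) / (w - z) - l)%C
        with ((f w - f z - l * (w - z)) / (w - z))%C by (field; exact Hwz).
      assert (0 < Cmod (w - z)) by now apply Cmod_gt_0.
      rewrite Cmod_div by exact Hwz; apply Rlt_div_l; [assumption|]; nra.
  - destruct (Ceq_dec z z) as [_|n]; [reflexivity|contradiction].
  - apply locally_Cmod; exists 1; split; [lra|]; intros w _.
    destruct (Ceq_dec w z) as [->|Hn]; [ring|].
    field; intros E; apply Hn; replace w with (w - z + z)%C by ring; rewrite E; ring.
Qed.

(** The mean value theorem holds only for each component, at possibly different points; adding the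
    two bounds costs the factor 2. *)
Lemma mean_value_C (F f : R -> C) (M : R) :
  (forall t, 0 <= t <= 1 ->
     is_derive (fun s => fst (F s)) t (fst (f t)) /\
     is_derive (fun s => snd (F s)) t (snd (f t))) ->
  (forall t, 0 <= t <= 1 -> Cmod (f t) <= M) -> Cmod (F 1 - F 0) <= 2 * M.
Proof.
  intros HF HM.
  assert (H : forall g dg : R -> R,
    (forall t, 0 <= t <= 1 -> is_derive g t (dg t) /\ Rabs (dg t) <= M) ->
    Rabs (g 1 - g 0) <= M).
  { intros g dg Hg; destruct (MVT_gen g 0 1 dg) as [c [Hc E]].
    - intros x; rewrite Rmin_left, Rmax_right by lra; intros Hx; apply Hg; lra.
    - intros x; rewrite Rmin_left, Rmax_right by lra; intros Hx.
      apply continuity_pt_filterlim, (ex_derive_continuous (K := R_AbsRing) (V := R_NormedModule)).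
      exists (dg x); now apply Hg.
    - rewrite Rmin_left, Rmax_right in Hc by lra.
      rewrite E; replace (dg c * (1 - 0)) with (dg c) by ring; now apply Hg. }
  rewrite (surjective_pairing (F 1 - F 0)%C); eapply Rle_trans; [apply Cmod_pair_le|].
  assert (H1 : Rabs (fst (F 1) - fst (F 0)) <= M).
  { apply (H (fun s => fst (F s)) (fun t => fst (f t))); intros t Ht; split; [now apply HF|].
    eapply Rle_trans; [|apply (HM t Ht)]; eapply Rle_trans; [|apply Rmax_Cmod]; apply Rmax_l. }
  assert (H2 : Rabs (snd (F 1) - snd (F 0)) <= M).
  { apply (H (fun s => snd (F s)) (fun t => snd (f t))); intros t Ht; split; [now apply HF|].
    eapply Rle_trans; [|apply (HM t Ht)]; eapply Rle_trans; [|apply Rmax_Cmod]; apply Rmax_r. }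
  simpl; unfold Rminus in *; lra.
Qed.

Definition cexp (z : C) : C := (exp (fst z) * cos (snd z), exp (fst z) * sin (snd z)).

Lemma cexp_plus (z w : C) : cexp (z + w) = (cexp z * cexp w)%C.
Proof.
  unfold cexp; apply injective_projections; simpl;
    rewrite exp_plus, ?cos_plus, ?sin_plus; ring.
Qed.

Lemma cexp_0 : cexp 0 = 1%C.
Proof. unfold cexp; simpl; rewrite exp_0, cos_0, sin_0; unfold RtoC; f_equal; ring. Qed.

Lemma Cmod_cexp (z : C) : Cmod (cexp z) = exp (fst z).
Proof.
  unfold cexp, Cmod; simpl.
  replace (exp (fst z) * cos (snd z) * (exp (fst z) * cos (snd z) * 1) +
           exp (fst z) * sin (snd z) * (exp (fst z) * sin (snd z) * 1))
    with (exp (fst z) * exp (fst z) * (Rsqr (sin (snd z)) + Rsqr (cos (snd z))))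
    by (unfold Rsqr; ring).
  rewrite sin2_cos2, Rmult_1_r; apply sqrt_square, Rlt_le, exp_pos.
Qed.

Lemma cexp_neq_0 (z : C) : cexp z <> 0%C.
Proof. apply Cmod_gt_0; rewrite Cmod_cexp; apply exp_pos. Qed.

Lemma Cmod_scale_le (t : R) (h : C) : 0 <= t <= 1 -> Cmod (t * h) <= Cmod h.
Proof.
  intros Ht; rewrite Cmod_mult, Cmod_R, Rabs_pos_eq by lra.
  pose proof (Cmod_ge_0 h); nra.
Qed.

(** Along the segment t h, the derivative of each Taylor remainder is h times the preceding one. The
    factor 2 of [mean_value_C] and e <= 3 give the constants 6, 12 and 24 of this lemma and the next
    two. *)
Lemma cexp_remainder1 (h : C) : Cmod h <= 1 -> Cmod (cexp h - 1) <= 6 * Cmod h.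
Proof.
  intros Hh.
  replace (cexp h - 1)%C with (cexp (1 * h) - cexp (0 * h))%C.
  2:{ replace (1 * h)%C with h by ring; replace (0 * h)%C with (RtoC 0) by ring.
      now rewrite cexp_0. }
  replace (6 * Cmod h) with (2 * (Cmod h * 3)) by ring.
  apply (mean_value_C (fun t => cexp (t * h)) (fun t => h * cexp (t * h))%C).
  - intros t _; destruct h as [x y]; unfold cexp; simpl; split; auto_derive; auto;
      unfold Rminus; ring.
  - intros t Ht; rewrite Cmod_mult; apply Rmult_le_compat_l; [apply Cmod_ge_0|].
    rewrite Cmod_cexp; apply Rle_trans with (exp 1); [|apply exp_le_3].
    assert (Hle : forall u v, u <= v -> exp u <= exp v).
    { intros u v [Huv| ->]; [now apply Rlt_le, exp_increasing|lra]. }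
    apply Hle; pose proof (Cmod_scale_le t h Ht).
    eapply Rle_trans; [apply Rle_abs|]; eapply Rle_trans; [apply re_le_Cmod|lra].
Qed.

Lemma cexp_remainder2 (h : C) : Cmod h <= 1 -> Cmod (cexp h - 1 - h) <= 12 * Cmod h ^ 2.
Proof.
  intros Hh; pose (F := fun t : R => (cexp (t * h) - t * h)%C).
  replace (cexp h - 1 - h)%C with (F 1 - F 0)%C.
  2:{ unfold F; replace (1 * h)%C with h by ring; replace (0 * h)%C with (RtoC 0) by ring.
      rewrite cexp_0; ring. }
  replace (12 * Cmod h ^ 2) with (2 * (Cmod h * (6 * Cmod h))) by ring.
  apply (mean_value_C F (fun t => h * (cexp (t * h) - 1))%C).
  - intros t _; destruct h as [x y]; unfold F, cexp; simpl; split; auto_derive; auto;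
      unfold Rminus; ring.
  - intros t Ht; rewrite Cmod_mult; apply Rmult_le_compat_l; [apply Cmod_ge_0|].
    pose proof (Cmod_scale_le t h Ht).
    eapply Rle_trans; [apply cexp_remainder1; lra|lra].
Qed.

Lemma cexp_remainder3 (h : C) : Cmod h <= 1 ->
  Cmod (cexp h - 1 - h - h * h / 2) <= 24 * Cmod h ^ 3.
Proof.
  intros Hh; pose (F := fun t : R => (cexp (t * h) - t * h - (t * h) * (t * h) / 2)%C).
  replace (cexp h - 1 - h - h * h / 2)%C with (F 1 - F 0)%C.
  2:{ unfold F; replace (1 * h)%C with h by ring; replace (0 * h)%C with (RtoC 0) by ring.
      rewrite cexp_0; field. }
  replace (24 * Cmod h ^ 3) with (2 * (Cmod h * (12 * Cmod h ^ 2))) by ring.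
  apply (mean_value_C F (fun t => h * (cexp (t * h) - 1 - t * h))%C).
  - intros t _; destruct h as [x y]; unfold F, cexp, Cdiv, Cinv; simpl; split;
      auto_derive; auto; unfold Rminus; field.
  - intros t Ht; rewrite Cmod_mult; apply Rmult_le_compat_l; [apply Cmod_ge_0|].
    pose proof (Cmod_scale_le t h Ht); pose proof (Cmod_ge_0 (t * h)).
    eapply Rle_trans; [apply cexp_remainder2; lra|].
    apply Rmult_le_compat_l; [lra|]; apply pow_incr; lra.
Qed.

Lemma cderiv_cexp (z : C) : cderiv cexp z (cexp z).
Proof.
  apply cderiv_intro; intros eps He.
  assert (Hm : 0 < Cmod (cexp z)) by (apply Cmod_gt_0, cexp_neq_0).
  exists (Rmin 1 (eps / (12 * Cmod (cexp z)))); split.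
  { apply Rmin_pos; [lra|]; apply Rdiv_lt_0_compat; lra. }
  intros w Hw.
  assert (H1 : Cmod (w - z) < 1) by (eapply Rlt_le_trans; [exact Hw|apply Rmin_l]).
  assert (H2 : Cmod (w - z) < eps / (12 * Cmod (cexp z)))
    by (eapply Rlt_le_trans; [exact Hw|apply Rmin_r]).
  apply Rlt_div_r in H2; [|lra].
  replace (cexp w) with (cexp z * cexp (w - z))%C by (rewrite <- cexp_plus; f_equal; ring).
  replace (cexp z * cexp (w - z) - cexp z - cexp z * (w - z))%C
    with (cexp z * (cexp (w - z) - 1 - (w - z)))%C by ring.
  rewrite Cmod_mult; pose proof (Cmod_ge_0 (w - z)) as H0.
  eapply Rle_trans; [apply Rmult_le_compat_l; [lra|apply cexp_remainder2; lra]|].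
  replace (Cmod (cexp z) * (12 * Cmod (w - z) ^ 2))
    with (Cmod (w - z) * (12 * Cmod (cexp z)) * Cmod (w - z)) by ring.
  apply Rmult_le_compat_r; lra.
Qed.

(** This form yields the modulus at once; the exponential form [csin_cexp] yields the derivative and
    the Taylor remainder. *)
Definition csin (z : C) : C :=
  (sin (fst z) * cosh (snd z), cos (fst z) * sinh (snd z)).

Lemma csin_cexp (z : C) : csin z = ((cexp (Ci * z) - cexp (- Ci * z)) / (2 * Ci))%C.
Proof.
  destruct z as [x y]; unfold csin, cexp, cosh, sinh, Ci, RtoC, Cdiv, Cinv; simpl.
  replace (0 * x - 1 * y) with (- y) by ring.
  replace (- 0 * x - - (1) * y) with y by ring.
  replace (0 * y + 1 * x) with x by ring.
  replace (- 0 * y + - (1) * x) with (- x) by ring.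
  rewrite cos_neg, sin_neg; apply injective_projections; simpl; field.
Qed.

Lemma csin_R (x : R) : csin (RtoC x) = RtoC (sin x).
Proof. unfold csin, RtoC; simpl; rewrite cosh_0, sinh_0; f_equal; ring. Qed.

Lemma cderiv_csin (z : C) : exists l, cderiv csin z l.
Proof.
  assert (Hlin : forall k : C,
    cderiv (fun w => cexp (k * w))%C z (cexp (k * z) * (0 * z + k * 1))%C).
  { intros k; apply (cderiv_comp cexp (fun w => k * w)%C); [apply cderiv_cexp|].
    apply cderiv_mult; [apply cderiv_const|apply cderiv_id]. }
  eexists; apply (cderiv_ext_loc
    (fun w => (cexp (Ci * w) + - (1) * cexp (- Ci * w)) * / (2 * Ci))%C).
  - apply locally_Cmod; exists 1; split; [lra|]; intros w _; rewrite csin_cexp; unfold Cdiv; ring.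
  - apply cderiv_mult; [|apply cderiv_const].
    apply cderiv_plus; [apply Hlin|]; apply cderiv_mult; [apply cderiv_const|apply Hlin].
Qed.

(** The even terms of e^{ih} and e^{-ih} cancel, leaving two remainders of third order divided by
    2. *)
Lemma Cmod_csin_remainder (h : C) : Cmod h <= 1 -> Cmod (csin h - h) <= 24 * Cmod h ^ 3.
Proof.
  intros Hh; rewrite csin_cexp.
  assert (HCi : Ci <> 0%C) by (apply Cmod_gt_0; rewrite Cmod_Ci; lra).
  assert (H2 : RtoC 2 <> 0%C) by (apply Cmod_gt_0; rewrite Cmod_R, Rabs_pos_eq; lra).
  set (p := (Ci * h)%C); set (q := (- Ci * h)%C).
  assert (Hp : Cmod p = Cmod h) by (unfold p; rewrite Cmod_mult, Cmod_Ci; ring).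
  assert (Hq : Cmod q = Cmod h) by (unfold q; rewrite Cmod_mult, Cmod_opp, Cmod_Ci; ring).
  replace ((cexp p - cexp q) / (2 * Ci) - h)%C with
    (((cexp p - 1 - p - p * p / 2) - (cexp q - 1 - q - q * q / 2)) / (2 * Ci))%C
    by (unfold p, q; field; auto).
  rewrite Cmod_div by now apply Cmult_neq_0.
  rewrite Cmod_mult, Cmod_Ci, Cmod_R, Rabs_pos_eq by lra.
  pose proof (cexp_remainder3 p ltac:(lra)) as Kp; rewrite Hp in Kp.
  pose proof (cexp_remainder3 q ltac:(lra)) as Kq; rewrite Hq in Kq.
  pose proof (Cmod_minus_le (cexp p - 1 - p - p * p / 2) (cexp q - 1 - q - q * q / 2)); lra.
Qed.

Definition csinc (z : C) : C := if Ceq_dec z 0 then RtoC 1 else (csin z / z)%C.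

Lemma csinc_0 : csinc 0 = 1%C.
Proof. unfold csinc; destruct (Ceq_dec 0 0) as [|n]; [reflexivity|now elim n]. Qed.

Lemma csin_csinc (z : C) : csin z = (z * csinc z)%C.
Proof.
  unfold csinc; destruct (Ceq_dec z 0) as [->|n]; [|field; exact n].
  rewrite csin_R, sin_0; ring.
Qed.

(** From |sin w / w - 1| <= 24 |w|^2. This derivative gives the simple poles of 1 / sin z at the
    multiples of PI, and later the limit of the residue at [v]. *)
Lemma cderiv_csinc_0 : cderiv csinc 0 0.
Proof.
  apply cderiv_intro; intros eps He; exists (Rmin 1 (eps / 24)); split.
  { apply Rmin_pos; lra. }
  rewrite csinc_0; intros w; replace (w - 0)%C with w by ring; intros Hw.
  assert (H1 : Cmod w < 1) by (eapply Rlt_le_trans; [exact Hw|apply Rmin_l]).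
  assert (H2 : Cmod w < eps / 24) by (eapply Rlt_le_trans; [exact Hw|apply Rmin_r]).
  pose proof (Cmod_ge_0 w) as H0.
  unfold csinc; destruct (Ceq_dec w 0) as [->|Hn].
  - replace (1 - 1 - 0 * 0)%C with (RtoC 0) by ring; rewrite Cmod_0; lra.
  - replace (csin w / w - 1 - 0 * w)%C with ((csin w - w) / w)%C by (field; exact Hn).
    assert (0 < Cmod w) by now apply Cmod_gt_0.
    rewrite Cmod_div by exact Hn; apply Rle_div_l; [assumption|].
    eapply Rle_trans; [apply Cmod_csin_remainder; lra|].
    replace (24 * Cmod w ^ 3) with (24 * Cmod w * Cmod w * Cmod w) by ring.
    repeat apply Rmult_le_compat_r; lra.
Qed.

Definition altsign (k : Z) : R := powerRZ (-1) k.

Lemma altsign_succ (k : Z) : altsign (Z.succ k) = - altsign k.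
Proof. unfold altsign, Z.succ; rewrite powerRZ_add by lra; simpl; ring. Qed.

Lemma altsign_sqr (k : Z) : altsign k * altsign k = 1.
Proof.
  induction k as [|k IH|k IH] using Z.peano_ind.
  - unfold altsign; simpl; ring.
  - rewrite altsign_succ; lra.
  - rewrite <- (Z.succ_pred k), altsign_succ in IH; lra.
Qed.

Lemma trig_plus_kPI (x : R) (k : Z) :
  sin (x + IZR k * PI) = altsign k * sin x /\ cos (x + IZR k * PI) = altsign k * cos x.
Proof.
  assert (Hs : forall m,
    sin (x + IZR (Z.succ m) * PI) = - sin (x + IZR m * PI) /\
    cos (x + IZR (Z.succ m) * PI) = - cos (x + IZR m * PI)).
  { intros m; rewrite succ_IZR.
    replace (x + (IZR m + 1) * PI) with (x + IZR m * PI + PI) by ring.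
    now rewrite neg_sin, neg_cos. }
  induction k as [|k [IH1 IH2]|k [IH1 IH2]] using Z.peano_ind.
  - unfold altsign; simpl; rewrite !Rmult_0_l, !Rplus_0_r; split; ring.
  - destruct (Hs k) as [-> ->]; rewrite altsign_succ, IH1, IH2; split; ring.
  - destruct (Hs (Z.pred k)) as [E1 E2]; rewrite Z.succ_pred in E1, E2.
    rewrite <- (Z.succ_pred k), altsign_succ, Z.succ_pred in IH1, IH2; lra.
Qed.

Lemma csin_plus_kPI (z : C) (k : Z) :
  csin (z + RtoC (IZR k * PI)) = (altsign k * csin z)%C.
Proof.
  destruct z as [x y]; unfold csin, RtoC; simpl; rewrite Rplus_0_r.
  destruct (trig_plus_kPI x k) as [-> ->]; apply injective_projections; simpl; ring.
Qed.

Lemma sin_kPI (k : Z) : sin (IZR k * PI) = 0.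
Proof.
  destruct (trig_plus_kPI 0 k) as [H _]; rewrite Rplus_0_l in H; rewrite H, sin_0; ring.
Qed.

Lemma Cmod_csin_sqr (x y : R) : Cmod (csin (x, y)) ^ 2 = sin x ^ 2 + sinh y ^ 2.
Proof.
  rewrite Cmod2_alt; unfold csin; simpl.
  assert (H1 : sin x ^ 2 + cos x ^ 2 = 1) by (pose proof (sin2_cos2 x); unfold Rsqr in *; lra).
  assert (H2 : cosh y ^ 2 = 1 + sinh y ^ 2).
  { unfold cosh, sinh; assert (H : exp y * exp (- y) = 1)
      by (rewrite <- exp_plus, Rplus_opp_r; apply exp_0); simpl; nra. }
  replace (sin x * cosh y * (sin x * cosh y * 1) + cos x * sinh y * (cos x * sinh y * 1))
    with (sin x ^ 2 * cosh y ^ 2 + cos x ^ 2 * sinh y ^ 2) by ring.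
  rewrite H2; replace (cos x ^ 2) with (1 - sin x ^ 2) by lra; ring.
Qed.

Lemma sinh_abs (y : R) : sinh y ^ 2 = sinh (Rabs y) ^ 2.
Proof.
  unfold Rabs; destruct Rcase_abs; [|reflexivity].
  unfold sinh; rewrite Ropp_involutive; field.
Qed.

Lemma csin_neq_0 (x y : R) : y <> 0 \/ sin x <> 0 -> csin (x, y) <> 0%C.
Proof.
  intros H E; pose proof (Cmod_csin_sqr x y) as Hs; rewrite E, Cmod_0 in Hs.
  assert (Hx : sin x ^ 2 = 0 /\ sinh y ^ 2 = 0)
    by (pose proof (pow2_ge_0 (sin x)); pose proof (pow2_ge_0 (sinh y)); lra).
  destruct Hx as [Hx Hy]; destruct H as [H|H].
  - rewrite sinh_abs in Hy; apply Rabs_pos_lt in H.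
    assert (Hp : 0 < sinh (Rabs y)).
    { unfold sinh; assert (exp (- Rabs y) < exp (Rabs y)) by (apply exp_increasing; lra); lra. }
    pose proof (pow_lt _ 2 Hp); lra.
  - revert Hx; now apply pow_nonzero.
Qed.

(** The alternatives are the two kinds of sides of the contour. On the vertical ones |sin z| = cosh
    y >= e^|y| / 2. On the horizontal ones |sin z| >= sinh |y|, and e^{-|y|} <= e^|y| / 2 brings the
    constant down to 1/4. *)
Lemma csin_lower_bound (x y : R) : 1 <= Rabs y \/ sin x ^ 2 = 1 ->
  exp (Rabs y) / 4 <= Cmod (csin (x, y)).
Proof.
  intros H; apply Rsqr_incr_0_var; [|apply Cmod_ge_0].
  rewrite !Rsqr_pow2, Cmod_csin_sqr, sinh_abs.
  set (t := Rabs y) in *; assert (Ht : 0 <= t) by apply Rabs_pos.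
  assert (He : exp t * exp (- t) = 1) by (rewrite <- exp_plus, Rplus_opp_r; apply exp_0).
  pose proof (exp_pos t); pose proof (exp_pos (- t)); pose proof (pow2_ge_0 (sin x)).
  unfold sinh; destruct H as [H|H].
  - assert (Het : 2 <= exp t) by (pose proof (exp_ineq1_le t); lra).
    assert (exp (- t) <= exp t / 2) by nra.
    assert (exp t / 4 <= (exp t - exp (- t)) / 2) by lra; nra.
  - rewrite H; nra.
Qed.

(** * Residues of the interpolation kernel *)

Lemma Cminus_neq_0 (z a : C) : z <> a -> (z - a)%C <> 0%C.
Proof. intros H E; apply H; replace z with (z - a + a)%C by ring; rewrite E; ring. Qed.

(** The Caratheodory function of [phi] at [a] is exactly the regular part of phi w / (w - a). *)
Lemma simple_pole_intro (phi K : C -> C) (a l : C) : cderiv phi a l ->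
  @locally C_UniformSpace a (fun w => w <> a -> K w = phi w / (w - a))%C ->
  simple_pole K a (phi a).
Proof.
  intros (g & Hg & _ & He) HK; exists g; split; [exact Hg|].
  generalize (filter_and _ _ He HK); apply filter_imp; intros w [E1 E2] Hw.
  rewrite (E2 Hw), E1; field; exact (Cminus_neq_0 w a Hw).
Qed.

Lemma cderiv_minus_const (a z : C) : cderiv (fun w => w - a)%C z (1 + 0)%C.
Proof. apply (cderiv_plus (fun w => w) (fun _ => - a)%C); [apply cderiv_id|apply cderiv_const]. Qed.

Lemma ex_cderiv_mult (f g : C -> C) (z : C) :
  (exists l, cderiv f z l) -> (exists l, cderiv g z l) ->
  exists l, cderiv (fun w => f w * g w)%C z l.
Proof. intros [l Hl] [m Hm]; eexists; apply cderiv_mult; eassumption. Qed.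

Lemma ex_cderiv_div (f g : C -> C) (z : C) :
  (exists l, cderiv f z l) -> (exists l, cderiv g z l) -> g z <> 0%C ->
  exists l, cderiv (fun w => f w / g w)%C z l.
Proof.
  intros Hf [m Hm] H0; apply ex_cderiv_mult; [exact Hf|].
  eexists; apply cderiv_inv; eassumption.
Qed.

Lemma ex_cderiv_ccont (f : C -> C) (z : C) : (exists l, cderiv f z l) -> ccont f z.
Proof. intros [l Hl]; now apply cderiv_ccont in Hl. Qed.

(** Poles enter in pairs k, -k around 0, so that the residues add up to a symmetric partial sum. *)
Fixpoint integer_poles (r : Z -> C) (N : nat) : list (R * C) :=
  let pole k := (IZR k * PI, r k) in
  match N with
  | O => [pole 0%Z]
  | S n => pole (- Z.of_nat (S n))%Z :: pole (Z.of_nat (S n)) :: integer_poles r n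
  end.

Lemma In_integer_poles (r : Z -> C) (N : nat) (p : R) (s : C) :
  In (p, s) (integer_poles r N) ->
  exists k, (Z.abs k <= Z.of_nat N)%Z /\ p = IZR k * PI /\ s = r k.
Proof.
  induction N as [|N IH]; cbn [integer_poles In].
  - intros [E|[]]; injection E as <- <-; exists 0%Z; repeat split; lia.
  - intros [E|[E|H]].
    + injection E as <- <-; eexists; repeat split; lia.
    + injection E as <- <-; eexists; repeat split; lia.
    + destruct (IH H) as (k & Hk & E); exists k; split; [lia|exact E].
Qed.

Lemma integer_poles_complete (r : Z -> C) (N : nat) (k : Z) :
  (Z.abs k <= Z.of_nat N)%Z -> In (IZR k * PI) (map fst (integer_poles r N)).
Proof.
  induction N as [|N IH]; intros Hk; cbn [integer_poles map fst In].
  - left; do 2 f_equal; lia.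
  - destruct (Z.eq_dec k (- Z.of_nat (S N))) as [->|H1]; [now left|].
    destruct (Z.eq_dec k (Z.of_nat (S N))) as [->|H2]; [now right; left|].
    right; right; apply IH; lia.
Qed.

Lemma IZR_PI_inj (j k : Z) : IZR j * PI = IZR k * PI -> j = k.
Proof.
  intros H; apply eq_IZR, (Rmult_eq_reg_r PI); [exact H|apply PI_neq0].
Qed.

Lemma NoDup_integer_poles (r : Z -> C) (N : nat) : NoDup (map fst (integer_poles r N)).
Proof.
  assert (H : forall n k, In (IZR k * PI) (map fst (integer_poles r n)) ->
    (Z.abs k <= Z.of_nat n)%Z).
  { intros n k Hin; apply in_map_iff in Hin; destruct Hin as [[p s] [E Hin]].
    destruct (In_integer_poles r n p s Hin) as (j & Hj & Ej & _); simpl in E; rewrite E in Ej.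
    apply IZR_PI_inj in Ej; subst j; exact Hj. }
  induction N as [|N IH]; cbn [integer_poles map fst].
  - constructor; [intros []|constructor].
  - constructor; [|constructor; [|exact IH]].
    + intros [E|Hin]; [apply IZR_PI_inj in E; lia|apply H in Hin; lia].
    + intros Hin; apply H in Hin; lia.
Qed.

(** The shift to [S N] arises because [Zstar_sum r N N] runs over 1 <= |k| <= N + 1. *)
Lemma csum_integer_poles (r : Z -> C) (N : nat) :
  csum (map snd (integer_poles r (S N))) = (r 0%Z + Zstar_sum r N N)%C.
Proof.
  induction N as [|N IH].
  - unfold Zstar_sum, csum; rewrite !sum_O; cbn -[Z.of_nat Cplus]; ring.
  - change (csum (map snd (integer_poles r (S (S N)))))
      with (r (- Z.of_nat (S (S N)))%Z + (r (Z.of_nat (S (S N)))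
              + csum (map snd (integer_poles r (S N)))))%C.
    rewrite IH; unfold Zstar_sum; rewrite !sum_Sn.
    change (@plus C_AbelianMonoid) with Cplus; ring.
Qed.

(** * The kernel with simple poles at u, v and the multiples of PI *)

Section Kernel.

Variables (G : C -> C) (B u v : R).
Hypothesis HG : forall z, exists l, cderiv G z l.
Hypothesis HB : forall x y, Cmod (G (x, y)) <= B * exp (Rabs y).
Hypothesis Huv : u <> v.
Hypothesis Hu : sin u <> 0.
Hypothesis Hv : sin v <> 0.

Definition kernel (z : C) : C := (G z / ((z - u) * (z - v) * csin z))%C.

(** The sign stands for 1 / cos (k PI), the reciprocal of the derivative of the sine. *)
Definition integer_residue (k : Z) : C :=
  (altsign k * G (IZR k * PI)%R / ((RtoC (IZR k * PI) - u) * (RtoC (IZR k * PI) - v)))%C.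

Lemma cderiv_kernel (z : C) : z <> u -> z <> v -> csin z <> 0%C -> exists l, cderiv kernel z l.
Proof.
  intros H1 H2 H3; apply ex_cderiv_div; [apply HG| |].
  - repeat apply ex_cderiv_mult; try apply cderiv_csin; eexists; apply cderiv_minus_const.
  - repeat apply Cmult_neq_0; auto using Cminus_neq_0.
Qed.

Lemma kernel_pole_u : simple_pole kernel u (G u / ((RtoC u - v) * csin u))%C.
Proof.
  assert (H0 : ((RtoC u - v) * csin u)%C <> 0%C).
  { apply Cmult_neq_0; [apply Cminus_neq_0; intros E; apply Huv; now apply RtoC_inj|].
    apply csin_neq_0; now right. }
  assert (Hd : exists l, cderiv (fun w => (w - v) * csin w)%C u l).
  { apply ex_cderiv_mult; [eexists; apply cderiv_minus_const|apply cderiv_csin]. }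
  destruct (ex_cderiv_div G (fun w => (w - v) * csin w)%C u (HG u) Hd H0) as [l Hl].
  apply (simple_pole_intro _ _ _ _ Hl).
  generalize (ccont_nonzero _ _ (ex_cderiv_ccont _ _ Hd) H0); apply filter_imp.
  intros w Hw Hwu; unfold kernel; field; repeat split;
    first [now apply Cminus_neq_0|intros E; apply Hw; rewrite E; ring].
Qed.

Lemma kernel_pole_v : simple_pole kernel v (G v / ((RtoC v - u) * csin v))%C.
Proof.
  assert (H0 : ((RtoC v - u) * csin v)%C <> 0%C).
  { apply Cmult_neq_0; [apply Cminus_neq_0; intros E; apply Huv; now apply RtoC_inj|].
    apply csin_neq_0; now right. }
  assert (Hd : exists l, cderiv (fun w => (w - u) * csin w)%C v l).
  { apply ex_cderiv_mult; [eexists; apply cderiv_minus_const|apply cderiv_csin]. }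
  destruct (ex_cderiv_div G (fun w => (w - u) * csin w)%C v (HG v) Hd H0) as [l Hl].
  apply (simple_pole_intro _ _ _ _ Hl).
  generalize (ccont_nonzero _ _ (ex_cderiv_ccont _ _ Hd) H0); apply filter_imp.
  intros w Hw Hwu; unfold kernel; field; repeat split;
    first [now apply Cminus_neq_0|intros E; apply Hw; rewrite E; ring].
Qed.

Lemma RtoC_kPI_neq (k : Z) (x : R) : sin x <> 0 -> RtoC (IZR k * PI) <> RtoC x.
Proof. intros Hx E; apply RtoC_inj in E; apply Hx; rewrite <- E; apply sin_kPI. Qed.

(** With a = k PI one has sin w = (-1)^k (w - a) sinc (w - a), which isolates the zero of the sine
    from a factor that is differentiable and nonzero at a. *)
Lemma kernel_pole_kPI (k : Z) : simple_pole kernel (RtoC (IZR k * PI)) (integer_residue k).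
Proof.
  set (a := RtoC (IZR k * PI)).
  pose (h := fun w => ((w - u) * (w - v) * csinc (w - a))%C).
  assert (Ha : csinc (a - a) = 1%C) by (replace (a - a)%C with (RtoC 0) by ring; apply csinc_0).
  assert (H0 : h a <> 0%C).
  { unfold h; rewrite Ha; repeat apply Cmult_neq_0;
      try (apply Cminus_neq_0; now apply RtoC_kPI_neq); intros E; apply RtoC_inj in E; lra. }
  assert (Hd : exists l, cderiv h a l).
  { apply ex_cderiv_mult; [apply ex_cderiv_mult; eexists; apply cderiv_minus_const|].
    eexists; apply (cderiv_comp csinc (fun w => w - a)%C); [|apply cderiv_minus_const].
    replace (a - a)%C with (RtoC 0) by ring; apply cderiv_csinc_0. }
  pose (phi := fun w => (altsign k * G w / h w)%C).
  assert (Hphi : exists l, cderiv phi a l).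
  { apply ex_cderiv_div; [|exact Hd|exact H0].
    apply ex_cderiv_mult; [eexists; apply cderiv_const|apply HG]. }
  destruct Hphi as [l Hl].
  replace (integer_residue k) with (phi a)
    by (unfold phi, h, integer_residue; fold a; rewrite Ha; f_equal; ring).
  apply (simple_pole_intro _ _ _ _ Hl).
  generalize (ccont_nonzero _ _ (ex_cderiv_ccont _ _ Hd) H0); apply filter_imp.
  intros w Hw Hwa; unfold kernel, phi.
  assert (Hs : (RtoC (altsign k) * RtoC (altsign k))%C = 1%C)
    by (rewrite <- RtoC_mult, altsign_sqr; reflexivity).
  assert (Hs0 : RtoC (altsign k) <> 0%C).
  { intros E; rewrite E in Hs; replace (0 * 0)%C with (RtoC 0) in Hs by ring.
    apply RtoC_inj in Hs; lra. }
  replace (csin w) with (altsign k * ((w - a) * csinc (w - a)))%C.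
  2:{ rewrite <- csin_csinc, <- csin_plus_kPI; fold a; f_equal; ring. }
  unfold h in *.
  replace (G w) with (altsign k * altsign k * G w)%C at 1 by (rewrite Hs; ring).
  field; repeat split; try exact Hs0; try (now apply Cminus_neq_0);
    intros E; apply Hw; rewrite E; ring.
Qed.

Lemma sin_half_odd (N : nat) (X : R) : X = (INR N + / 2) * PI -> sin X ^ 2 = 1.
Proof.
  intros ->; replace ((INR N + / 2) * PI) with (PI / 2 + IZR (Z.of_nat N) * PI)
    by (rewrite <- INR_IZR_INZ; field).
  destruct (trig_plus_kPI (PI / 2) (Z.of_nat N)) as [-> _]; rewrite sin_PI2.
  pose proof (altsign_sqr (Z.of_nat N)); simpl; lra.
Qed.

(** On the contour |z| >= X, so |z - u| and |z - v| are at least X / 2. With |sin z| >= e^|y| / 4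
    the growth of G cancels and the constant is 2 * 2 * 4 = 16. *)
Lemma kernel_bound (N : nat) (X x y : R) :
  X = (INR N + / 2) * PI -> 2 * Rabs u <= X -> 2 * Rabs v <= X ->
  x = - X \/ x = X \/ y = - X \/ y = X ->
  csin (x, y) <> 0%C /\ (x, y) <> RtoC u /\ (x, y) <> RtoC v /\
  Cmod (kernel (x, y)) <= 16 * B / (X * X).
Proof.
  intros HX HuX HvX Hxy.
  assert (HX1 : 1 < X).
  { pose proof (pos_INR N); pose proof PI2_1; subst X; unfold PI2 in *; nra. }
  assert (HXa : Rabs X = X) by (apply Rabs_pos_eq; lra).
  assert (Hlow : exp (Rabs y) / 4 <= Cmod (csin (x, y))).
  { apply csin_lower_bound; destruct Hxy as [-> |[-> |[-> | ->]]].
    - right; rewrite sin_neg; replace ((- sin X) ^ 2) with (sin X ^ 2) by ring.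
      now apply (sin_half_odd N).
    - right; now apply (sin_half_odd N).
    - left; rewrite Rabs_Ropp; lra.
    - left; lra. }
  assert (Hz : X <= Cmod (x, y)).
  { rewrite <- HXa; eapply Rle_trans; [|apply Rmax_Cmod]; simpl.
    destruct Hxy as [-> |[-> |[-> | ->]]]; rewrite ?Rabs_Ropp; apply Rmax_l || apply Rmax_r. }
  assert (Hdist : forall t, 2 * Rabs t <= X -> X / 2 <= Cmod ((x, y) - RtoC t)).
  { intros t Ht; pose proof (Cmod_minus_ge (x, y) (RtoC t)) as H; rewrite Cmod_R in H; lra. }
  pose proof (Hdist u HuX) as Du; pose proof (Hdist v HvX) as Dv.
  pose proof (exp_pos (Rabs y)) as He.
  assert (Hne : forall t : R, X / 2 <= Cmod ((x, y) - RtoC t) -> (x, y) <> RtoC t).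
  { intros t Ht E; rewrite E in Ht; replace (RtoC t - RtoC t)%C with (RtoC 0) in Ht by ring.
    rewrite Cmod_0 in Ht; lra. }
  assert (Hs0 : csin (x, y) <> 0%C) by (apply Cmod_gt_0; lra).
  split; [exact Hs0|]; split; [now apply Hne|]; split; [now apply Hne|].
  unfold kernel; rewrite Cmod_div by (repeat apply Cmult_neq_0; auto using Cminus_neq_0).
  rewrite !Cmod_mult.
  assert (Hden : X / 2 * (X / 2) * (exp (Rabs y) / 4) <=
    Cmod ((x, y) - u) * Cmod ((x, y) - v) * Cmod (csin (x, y))).
  { apply Rmult_le_compat; try lra; [nra|]; apply Rmult_le_compat; lra. }
  assert (Hd0 : 0 < X / 2 * (X / 2) * (exp (Rabs y) / 4)).
  { repeat apply Rmult_lt_0_compat; lra. }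
  apply Rle_div_l; [lra|].
  eapply Rle_trans; [apply HB|].
  assert (HB0 : 0 <= B).
  { pose proof (HB 0 0) as H; rewrite Rabs_R0, exp_0 in H.
    pose proof (Cmod_ge_0 (G (0, 0))); lra. }
  replace (B * exp (Rabs y)) with (16 * B / (X * X) * (X / 2 * (X / 2) * (exp (Rabs y) / 4)))
    by (field; lra).
  apply Rmult_le_compat_l; [|exact Hden].
  apply Rdiv_le_0_compat; nra.
Qed.

(** The contour has length 8 X and the kernel is at most 16 B / X^2 on it; dividing 128 B / X by 2
    PI leaves less than 64 B / X. The square uses [S N] to enclose the poles with |k| <= N + 1. *)
Lemma residue_sum_bound (N : nat) (X : R) :
  X = (INR (S N) + / 2) * PI -> 2 * Rabs u <= X -> 2 * Rabs v <= X ->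
  Cmod (G u / ((RtoC u - v) * csin u) + G v / ((RtoC v - u) * csin v)
        + integer_residue 0 + Zstar_sum integer_residue N N) <= 64 * B / X.
Proof.
  intros HX HuX HvX.
  assert (HPI : 2 < PI) by (pose proof PI2_1; unfold PI2 in *; lra).
  assert (HX1 : 1 < X).
  { pose proof (pos_INR N); rewrite S_INR in HX; subst X; nra. }
  set (poles := (u, G u / ((RtoC u - v) * csin u))%C :: (v, G v / ((RtoC v - u) * csin v))%C
                  :: integer_poles integer_residue (S N)).
  assert (Habs : forall t, 2 * Rabs t <= X -> - X < t < X).
  { intros t Ht; assert (Rabs t < X) by lra; now apply Rabs_def2 in H. }
  assert (Hoff : forall x, sin x <> 0 -> ~ In x (map fst (integer_poles integer_residue (S N)))).
  { intros x Hx Hin; apply in_map_iff in Hin; destruct Hin as [[p s] [E Hin]]; simpl in E; subst p.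
    destruct (In_integer_poles _ _ _ _ Hin) as (k & _ & E & _).
    apply Hx; rewrite E; apply sin_kPI. }
  assert (Hres : bdint kernel (- X) X (- X) X = (2 * PI * Ci * csum (map snd poles))%C).
  { apply residue_theorem_real_poles; try lra.
    - constructor; [|constructor].
      + intros [E|Hin]; [now apply Huv|now apply (Hoff u)].
      + now apply Hoff.
      + apply NoDup_integer_poles.
    - intros [x y] _ Hy; simpl in Hy; apply cderiv_kernel.
      + intros E; injection E; lra.
      + intros E; injection E; lra.
      + apply csin_neq_0; now left.
    - intros x Hx Hin; unfold poles in Hin; cbn [map In fst] in Hin.
      apply ex_cderiv_ccont, cderiv_kernel.
      + intros E; injection E; intros; apply Hin; now left.
      + intros E; injection E; intros; apply Hin; now right; left.
      + apply csin_neq_0; right; intros E; apply sin_eq_0_0 in E; destruct E as [k ->].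
        apply Hin; right; right; apply integer_poles_complete.
        (* A multiple of PI in [-X, X] has |k| < S N + 1, so it is one of the listed poles. *)
        assert (Hk : Rabs (IZR k) * PI < (INR (S N) + 1) * PI).
        { rewrite <- (Rabs_pos_eq PI) at 1 by lra; rewrite <- Rabs_mult.
          apply Rle_lt_trans with X; [now apply Rabs_le|]; subst X; lra. }
        apply Rmult_lt_reg_r in Hk; [|lra].
        rewrite INR_IZR_INZ, <- plus_IZR, <- abs_IZR in Hk; apply lt_IZR in Hk; lia.
    - intros p r [E|[E|Hin]].
      + injection E as <- <-; split; [now apply Habs|apply kernel_pole_u].
      + injection E as <- <-; split; [now apply Habs|apply kernel_pole_v].
      + destruct (In_integer_poles _ _ _ _ Hin) as (k & Hk & -> & ->).
        split; [|apply kernel_pole_kPI].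
        apply IZR_le in Hk; rewrite abs_IZR, <- INR_IZR_INZ in Hk.
        assert (H : Rabs (IZR k * PI) < X).
        { rewrite Rabs_mult, (Rabs_pos_eq PI) by lra; subst X; apply Rmult_lt_compat_r; lra. }
        apply Rabs_def2 in H; lra. }
  assert (Hle : Cmod (bdint kernel (- X) X (- X) X) <=
    2 * (X - - X + (X - - X)) * (16 * B / (X * X))).
  { apply bdint_le; try lra.
    - assert (Hc : forall x y, x = - X \/ x = X \/ y = - X \/ y = X -> ccont kernel (x, y)).
      { intros x y Hxy; destruct (kernel_bound (S N) X x y HX HuX HvX Hxy) as (H1 & H2 & H3 & _).
        now apply ex_cderiv_ccont, cderiv_kernel. }
      split; split; intros t _; apply Hc; auto.
    - intros [x y] _ Hxy; now apply (kernel_bound (S N)). }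
  rewrite Hres, !Cmod_mult, Cmod_Ci, !Cmod_R, (Rabs_pos_eq 2), (Rabs_pos_eq PI) in Hle by lra.
  replace (csum (map snd poles)) with
    (G u / ((RtoC u - v) * csin u) + G v / ((RtoC v - u) * csin v)
        + integer_residue 0 + Zstar_sum integer_residue N N)%C in Hle.
  2:{ unfold poles; cbn [map snd csum fold_right].
      change (fold_right Cplus (RtoC 0)) with csum.
      rewrite csum_integer_poles; ring. }
  set (S0 := Cmod _) in Hle |- *.
  assert (HS0 : 0 <= S0) by apply Cmod_ge_0.
  replace (2 * (X - - X + (X - - X)) * (16 * B / (X * X))) with (2 * (64 * B / X)) in Hle
    by (field; lra).
  nra.
Qed.

End Kernel.

(** * Two-sided series *)

Lemma INR_S_pos (n : nat) : 0 < INR (S n).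
Proof. apply lt_0_INR; lia. Qed.

(** Comparison with 1 / (x (x + 1)) makes the tails telescope and yields the explicit rates
    below. *)
Lemma inv_square_telescope (n : nat) :
  / INR (S (S n)) ^ 2 <= / INR (S n) - / INR (S (S n)).
Proof.
  pose proof (INR_S_pos n) as H; rewrite (S_INR (S n)); set (x := INR (S n)) in *; clearbody x.
  replace (/ x - / (x + 1)) with (/ (x * (x + 1))) by (field; lra).
  apply Rinv_le_contravar; nra.
Qed.

Lemma sum_n_tail_bound (a : nat -> C) (A : R) (m n : nat) :
  (forall j, Cmod (a j) <= A * / INR (S j) ^ 2) -> (m <= n)%nat ->
  Cmod (sum_n a n - sum_n a m) <= A * (/ INR (S m) - / INR (S n)).
Proof.
  intros Ha H.
  assert (HA : 0 <= A).
  { specialize (Ha 0%nat); simpl in Ha; pose proof (Cmod_ge_0 (a 0%nat)); lra. }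
  induction H as [|n H IH].
  - replace (sum_n a m - sum_n a m)%C with (RtoC 0) by ring; rewrite Cmod_0; lra.
  - rewrite sum_Sn; change (@plus C_AbelianMonoid) with Cplus.
    replace (sum_n a n + a (S n) - sum_n a m)%C with (sum_n a n - sum_n a m + a (S n))%C by ring.
    eapply Rle_trans; [apply Cmod_triangle|].
    pose proof (inv_square_telescope n) as Ht; specialize (Ha (S n)); nra.
Qed.

Lemma ex_series_inv_square (A : R) : 0 <= A -> ex_series (fun j => A * / INR (S j) ^ 2).
Proof.
  intros HA; apply (ex_series_scal_l A (fun j => / INR (S j) ^ 2)).
  destruct (ex_finite_lim_seq_incr (sum_n (fun j => / INR (S j) ^ 2)) 2) as [l Hl].
  - intros n; rewrite sum_Sn; change plus with Rplus.
    assert (0 < / INR (S (S n)) ^ 2) by (apply Rinv_0_lt_compat, pow_lt, INR_S_pos); lra.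
  - intros n; apply Rle_trans with (2 - / INR (S n)).
    + induction n as [|n IH]; [rewrite sum_O; simpl; lra|].
      rewrite sum_Sn; change plus with Rplus; pose proof (inv_square_telescope n); lra.
    + assert (0 < / INR (S n)) by apply Rinv_0_lt_compat, INR_S_pos; lra.
  - exists l; exact Hl.
Qed.

(** The rate depends on the terms only through [A]; uniform convergence in a parameter will follow
    from a common value of [A]. *)
Lemma sum_n_limit_bound (a : nat -> C) (A : R) :
  (forall j, Cmod (a j) <= A * / INR (S j) ^ 2) ->
  exists l, forall m, Cmod (sum_n a m - l) <= A * / INR (S m).
Proof.
  intros Ha.
  assert (HA : 0 <= A).
  { generalize (Ha 0%nat); simpl; pose proof (Cmod_ge_0 (a 0%nat)); lra. }
  destruct (ex_series_le (K := C_AbsRing) (V := C_CompleteNormedModule) a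
              (fun j => A * / INR (S j) ^ 2) Ha (ex_series_inv_square A HA)) as [l Hl].
  exists l; intros m; apply le_epsilon; intros eps He.
  assert (Hloc : @locally C_UniformSpace l (fun w => Cmod (w - l) < eps)).
  { apply locally_Cmod; exists eps; auto. }
  destruct (Hl _ Hloc) as [N HN]; specialize (HN (Nat.max N m) (Nat.le_max_l _ _)).
  change (Cmod (sum_n a (Nat.max N m) - l) < eps) in HN.
  pose proof (sum_n_tail_bound a A m (Nat.max N m) Ha (Nat.le_max_r _ _)) as Ht.
  assert (0 < / INR (S (Nat.max N m))) by apply Rinv_0_lt_compat, INR_S_pos.
  replace (sum_n a m - l)%C with
    (- (sum_n a (Nat.max N m) - sum_n a m) + (sum_n a (Nat.max N m) - l))%C by ring.
  eapply Rle_trans; [apply Cmod_triangle|]; rewrite Cmod_opp.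
  assert (0 <= A * / INR (S (Nat.max N m))) by (apply Rmult_le_pos; lra); lra.
Qed.

Definition inv_square_bounded (t : Z -> C) (A : R) : Prop :=
  forall k, k <> 0%Z -> Cmod (t k) <= A * / (IZR k) ^ 2.

Lemma inv_square_bounded_sides (t : Z -> C) (A : R) : inv_square_bounded t A ->
  (forall j, Cmod (t (- Z.of_nat (S j))%Z) <= A * / INR (S j) ^ 2) /\
  (forall j, Cmod (t (Z.of_nat (S j))) <= A * / INR (S j) ^ 2).
Proof.
  intros H; split; intros j.
  - replace (INR (S j) ^ 2) with (IZR (- Z.of_nat (S j)) ^ 2).
    + apply H; lia.
    + rewrite opp_IZR, <- INR_IZR_INZ; ring.
  - replace (INR (S j) ^ 2) with (IZR (Z.of_nat (S j)) ^ 2).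
    + apply H; lia.
    + now rewrite <- INR_IZR_INZ.
Qed.

Lemma Zstar_abs_convergent_inv_square (t : Z -> C) (A : R) :
  0 <= A -> inv_square_bounded t A -> Zstar_abs_convergent t.
Proof.
  intros HA H; destruct (inv_square_bounded_sides t A H) as [H1 H2]; split;
    refine (ex_series_le (K := R_AbsRing) (V := R_CompleteNormedModule) _ _ _
              (ex_series_inv_square A HA));
    intros j; (eapply Rle_trans; [apply Req_le, Rabs_pos_eq, Cmod_ge_0|]); auto.
Qed.

(** Each side is at most 2 A: the first term contributes A, and the telescoping tail at most A. *)
Lemma Zstar_sum_bound (t : Z -> C) (A : R) (m n : nat) :
  inv_square_bounded t A -> Cmod (Zstar_sum t m n) <= 4 * A.
Proof.
  intros H.
  assert (Hone : forall a : nat -> C, (forall j, Cmod (a j) <= A * / INR (S j) ^ 2) ->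
    forall i, Cmod (sum_n a i) <= 2 * A).
  { intros a Ha i; pose proof (sum_n_tail_bound a A 0 i Ha (Nat.le_0_l _)) as Ht.
    rewrite sum_O in Ht; pose proof (Ha 0%nat) as H0; pose proof (Cmod_ge_0 (a 0%nat)).
    assert (0 < / INR (S i)) by apply Rinv_0_lt_compat, INR_S_pos.
    change (INR 1) with 1 in *; rewrite Rinv_1 in Ht; replace (/ 1 ^ 2) with 1 in H0 by field.
    pose proof (Cmod_minus_ge (sum_n a i) (a 0%nat)); nra. }
  destruct (inv_square_bounded_sides t A H) as [H1 H2].
  unfold Zstar_sum; eapply Rle_trans; [apply Cmod_triangle|].
  pose proof (Hone _ H1 m); pose proof (Hone _ H2 n); lra.
Qed.

Lemma Zstar_sum_limit (t : Z -> C) (A : R) : inv_square_bounded t A ->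
  exists s, forall m n, Cmod (Zstar_sum t m n - s) <= A * / INR (S m) + A * / INR (S n).
Proof.
  intros H; destruct (inv_square_bounded_sides t A H) as [H1 H2].
  destruct (sum_n_limit_bound _ A H1) as [s1 K1].
  destruct (sum_n_limit_bound _ A H2) as [s2 K2].
  exists (s1 + s2)%C; intros m n; unfold Zstar_sum.
  match goal with |- Cmod (?a + ?b - _) <= _ =>
    replace (a + b - (s1 + s2))%C with ((a - s1) + (b - s2))%C by ring end.
  eapply Rle_trans; [apply Cmod_triangle|]; apply Rplus_le_compat; auto.
Qed.

Lemma inv_INR_small (A eps : R) : 0 < eps ->
  exists N : nat, forall n, (N <= n)%nat -> A * / INR (S n) < eps.
Proof.
  (* Taking the maximum with 0 keeps the integer positive when [A] is negative, so that [Z.to_nat]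
     preserves its value. *)
  intros He; destruct (archimed (Rmax 0 (A / eps))) as [Hup _].
  assert (H0 : 0 < IZR (up (Rmax 0 (A / eps)))) by (pose proof (Rmax_l 0 (A / eps)); lra).
  exists (Z.to_nat (up (Rmax 0 (A / eps)))); intros n Hn.
  assert (Hi : IZR (up (Rmax 0 (A / eps))) <= INR (S n)).
  { rewrite INR_IZR_INZ; apply IZR_le; apply lt_IZR in H0; lia. }
  pose proof (Rmax_r 0 (A / eps)); pose proof (INR_S_pos n).
  apply Rlt_div_l; [assumption|].
  assert (Hae : A / eps < INR (S n)) by lra; apply Rlt_div_l in Hae; lra.
Qed.

Lemma is_Zstar_series_unique (t : Z -> C) (s : C) : is_Zstar_series t s -> Zstar_series t = s.
Proof.
  intros H; unfold Zstar_series.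
  apply (iota_filterlim_locally (V := C_CompleteNormedModule)
           (F := filter_prod eventually eventually)); exact H.
Qed.

Lemma Zstar_series_limit (t : Z -> C) (s : C) (A : R) :
  (forall m n, Cmod (Zstar_sum t m n - s) <= A * / INR (S m) + A * / INR (S n)) ->
  Zstar_series t = s.
Proof.
  intros H; apply is_Zstar_series_unique; intros P HP.
  destruct (proj1 (locally_Cmod _ _) HP) as [e [He HPe]].
  destruct (inv_INR_small A (e / 2)) as [N HN]; [lra|].
  exists (fun m => (N <= m)%nat) (fun n => (N <= n)%nat); [now exists N|now exists N|].
  intros m n Hm Hn; apply HPe; eapply Rle_lt_trans; [apply (H m n)|].
  pose proof (HN m Hm); pose proof (HN n Hn); lra.
Qed.

Lemma sum_n_single (a : nat -> C) (i m : nat) :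
  (forall j, j <> i -> a j = 0%C) -> @eq C (sum_n a m) (if le_dec i m then a i else 0%C).
Proof.
  intros Ha; induction m as [|m IH].
  - rewrite sum_O; destruct (le_dec i 0); [f_equal; lia|apply Ha; lia].
  - rewrite sum_Sn, IH; change (@plus C_AbelianMonoid) with Cplus.
    destruct (le_dec i m), (le_dec i (S m)); try lia.
    + rewrite (Ha (S m)) by lia; ring.
    + replace (S m) with i by lia; ring.
    + rewrite (Ha (S m)) by lia; ring.
Qed.

Lemma Zstar_series_single (t : Z -> C) (k : Z) : k <> 0%Z ->
  (forall j, j <> k -> t j = 0%C) -> Zstar_series t = t k.
Proof.
  intros Hk Ht; apply is_Zstar_series_unique; intros P HP.
  pose (N := Z.to_nat (Z.abs k)).
  exists (fun m => (N <= m)%nat) (fun n => (N <= n)%nat); [now exists N|now exists N|].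
  intros m n Hm Hn; unfold N in Hm, Hn.
  assert (E : Zstar_sum t m n = t k); [|simpl; rewrite E; exact (locally_singleton _ _ HP)].
  unfold Zstar_sum; destruct (Z.lt_trichotomy k 0) as [H|[H|H]]; [|lia|].
  - rewrite (sum_n_single _ (Z.to_nat (- k) - 1)) by (intros j Hj; apply Ht; lia).
    (* All terms on the other side vanish: the index [S n] lies beyond the cut-off, so
       [sum_n_single] returns 0. On the side of k, the index is |k| - 1 because [j] stands for
       [S j]. *)
    rewrite (sum_n_single (fun j => t (Z.of_nat (S j))) (S n)) by (intros j Hj; apply Ht; lia).
    destruct (le_dec (Z.to_nat (- k) - 1) m), (le_dec (S n) n); try lia.
    replace (- Z.of_nat (S (Z.to_nat (- k) - 1)))%Z with k by lia; ring.
  - rewrite (sum_n_single _ (S m)) by (intros j Hj; apply Ht; lia).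
    rewrite (sum_n_single (fun j => t (Z.of_nat (S j))) (Z.to_nat k - 1))
      by (intros j Hj; apply Ht; lia).
    destruct (le_dec (Z.to_nat k - 1) n), (le_dec (S m) m); try lia.
    replace (Z.of_nat (S (Z.to_nat k - 1)))%Z with k by lia; ring.
Qed.

Lemma abs_sin_le (x : R) : Rabs (sin x) <= Rabs x.
Proof.
  assert (H : forall y, 0 <= y -> Rabs (sin y) <= y).
  { intros y Hy; destruct (Rle_lt_dec y 1) as [H1|H1].
    - destruct Hy as [Hy|<-]; [|rewrite sin_0, Rabs_R0; lra].
      pose proof PI2_1; unfold PI2 in *.
      assert (0 < sin y) by (apply sin_gt_0; lra).
      pose proof (sin_lt_x y Hy); rewrite Rabs_pos_eq; lra.
    - assert (Rabs (sin y) <= 1) by (apply Rabs_le, SIN_bound); lra. }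
  unfold Rabs at 2; destruct Rcase_abs as [Hx|Hx].
  - rewrite <- Rabs_Ropp, <- sin_neg; apply H; lra.
  - apply H; lra.
Qed.

(** By periodicity up to sign. It bounds the distance from u to all poles k PI below by the single
    number |sin u|. *)
Lemma abs_sin_le_dist (x : R) (k : Z) : Rabs (sin x) <= Rabs (IZR k * PI - x).
Proof.
  replace x with (x - IZR k * PI + IZR k * PI) at 1 by ring.
  destruct (trig_plus_kPI (x - IZR k * PI) k) as [-> _]; rewrite Rabs_mult.
  assert (Hs : Rabs (altsign k) = 1).
  { pose proof (altsign_sqr k) as H; pose proof (Rabs_pos (altsign k)).
    apply (f_equal Rabs) in H; rewrite Rabs_mult, Rabs_R1 in H; nra. }
  rewrite Hs, Rmult_1_l, <- Rabs_Ropp with (x := IZR k * PI - x).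
  eapply Rle_trans; [apply abs_sin_le|]; apply Req_le; f_equal; ring.
Qed.

(** * The limits N to infinity and v to 0 *)

Section Sampling.

Variables (G : C -> C) (B u : R) (G1 : C).
Hypothesis HG : forall z, exists l, cderiv G z l.
Hypothesis HG1 : cderiv G 0 G1.
Hypothesis HB : forall x y, Cmod (G (x, y)) <= B * exp (Rabs y).
Hypothesis Hu : sin u <> 0.

Lemma bound_on_reals (x : R) : Cmod (G (RtoC x)) <= B.
Proof. pose proof (HB x 0) as H; rewrite Rabs_R0, exp_0, Rmult_1_r in H; exact H. Qed.

(** The value of [integer_residue] at v = 0, meant for k <> 0; at k = 0 a double pole forms, treated
    in [sampling_formula]. *)
Definition limit_residue (k : Z) : C :=
  (altsign k * G (IZR k * PI)%R / ((RtoC (IZR k * PI) - u) * RtoC (IZR k * PI)))%C.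

Lemma Cmod_altsign (k : Z) : Cmod (altsign k) = 1.
Proof.
  pose proof (altsign_sqr k) as H; pose proof (Cmod_ge_0 (altsign k)).
  rewrite Cmod_R in *; apply (f_equal Rabs) in H; rewrite Rabs_mult, Rabs_R1 in H; nra.
Qed.

Lemma abs_IZR_ge_1 (k : Z) : k <> 0%Z -> 1 <= Rabs (IZR k).
Proof. intros Hk; rewrite <- abs_IZR; apply (IZR_le 1); lia. Qed.

(** Since 1 / (a - v) - 1 / a = v / ((a - v) a), the difference carries a factor v, while |k PI - v|
    and |k PI| are at least |k| and |k PI - u| >= |sin u|. The sum of the differences is therefore
    O(|v|) uniformly in N, which is what permits the two successive limits. *)
Lemma residue_difference_bound (v : R) : Rabs v <= 1 ->
  inv_square_bounded (fun k => integer_residue G u v k - limit_residue k)%C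
    (B / Rabs (sin u) * Rabs v).
Proof.
  intros Hv k Hk; pose proof (abs_IZR_ge_1 k Hk) as Hk1.
  assert (HPI : 2 < PI) by (pose proof PI2_1; unfold PI2 in *; lra).
  assert (Hs : 0 < Rabs (sin u)) by now apply Rabs_pos_lt.
  pose proof (abs_sin_le_dist u k) as Hd.
  assert (Hkp : Rabs (IZR k) <= Rabs (IZR k * PI)).
  { rewrite Rabs_mult, (Rabs_pos_eq PI) by lra; nra. }
  assert (Hkv : Rabs (IZR k) <= Rabs (IZR k * PI - v)).
  { pose proof (Rabs_triang_inv (IZR k * PI) v) as H.
    rewrite Rabs_mult, (Rabs_pos_eq PI) in H by lra; nra. }
  assert (Nz : forall x, 0 < Rabs x -> RtoC x <> 0%C).
  { intros x Hx; apply Cmod_gt_0; now rewrite Cmod_R. }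
  assert (Nu : RtoC (IZR k * PI - u) <> 0%C) by (apply Nz; lra).
  assert (Nv : RtoC (IZR k * PI - v) <> 0%C) by (apply Nz; lra).
  assert (Np : RtoC (IZR k * PI) <> 0%C) by (apply Nz; lra).
  replace (integer_residue G u v k - limit_residue k)%C with
    (altsign k * G (IZR k * PI)%R * v
      / (RtoC (IZR k * PI - u) * (RtoC (IZR k * PI - v) * RtoC (IZR k * PI))))%C.
  2:{ unfold integer_residue, limit_residue; rewrite !RtoC_minus in *; field; auto. }
  rewrite Cmod_div by (repeat apply Cmult_neq_0; assumption).
  rewrite !Cmod_mult, Cmod_altsign, !Cmod_R, Rmult_1_l.
  pose proof (bound_on_reals (IZR k * PI)) as HBk.
  pose proof (Rabs_pos v); pose proof (Cmod_ge_0 (G (RtoC (IZR k * PI)))).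
  replace (IZR k ^ 2) with (Rabs (IZR k) * Rabs (IZR k))
    by (rewrite <- Rabs_mult, Rabs_pos_eq; [ring|nra]).
  replace (B / Rabs (sin u) * Rabs v * / (Rabs (IZR k) * Rabs (IZR k))) with
    (B * Rabs v / (Rabs (sin u) * (Rabs (IZR k) * Rabs (IZR k)))) by (field; lra).
  unfold Rdiv; apply Rmult_le_compat.
  - apply Rmult_le_pos; assumption.
  - apply Rlt_le, Rinv_0_lt_compat; repeat apply Rmult_lt_0_compat; lra.
  - apply Rmult_le_compat_r; assumption.
  - apply Rinv_le_contravar; [repeat apply Rmult_lt_0_compat; lra|].
    apply Rmult_le_compat; [lra|nra|exact Hd|apply Rmult_le_compat; lra].
Qed.

Lemma Zstar_sum_minus (s t : Z -> C) (m n : nat) :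
  Zstar_sum (fun k => s k - t k)%C m n = (Zstar_sum s m n - Zstar_sum t m n)%C.
Proof.
  assert (H : forall (a b : nat -> C) i,
    @eq C (sum_n (fun j => a j - b j)%C i) (sum_n a i - sum_n b i)%C).
  { intros a b i; induction i as [|i IH]; [now rewrite !sum_O|].
    rewrite !sum_Sn, IH; change (@plus C_AbelianMonoid) with Cplus; ring. }
  unfold Zstar_sum.
  rewrite (H (fun j => s (- Z.of_nat (S j))%Z) (fun j => t (- Z.of_nat (S j))%Z)).
  rewrite (H (fun j => s (Z.of_nat (S j))) (fun j => t (Z.of_nat (S j)))); ring.
Qed.

Lemma limit_residue_near (S0 : C) (A v : R) :
  (forall m n, Cmod (Zstar_sum limit_residue m n - S0) <= A * / INR (S m) + A * / INR (S n)) ->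
  v <> u -> sin v <> 0 -> Rabs v <= 1 ->
  Cmod (G u / ((RtoC u - v) * csin u) + G v / ((RtoC v - u) * csin v)
        + integer_residue G u v 0 + S0) <= 4 * (B / Rabs (sin u)) * Rabs v.
Proof.
  intros HS Hvu Hv Hv1; apply le_epsilon; intros eps He.
  assert (HPI : 2 < PI) by (pose proof PI2_1; unfold PI2 in *; lra).
  assert (HB0 : 0 <= B).
  { pose proof (bound_on_reals 0); pose proof (Cmod_ge_0 (G (RtoC 0))); lra. }
  (* [N1] makes the two series tails at most 2 eps / 3 together, [N2] makes the contour bound at
     most eps / 3, and [N3] puts |u| and |v| below X / 2. The remaining 4 (B / |sin u|) |v| comes
     from [Zstar_sum_bound]. *)
  destruct (inv_INR_small A (eps / 3)) as [N1 K1]; [lra|].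
  destruct (inv_INR_small (64 * B) (eps / 3)) as [N2 K2]; [lra|].
  destruct (inv_INR_small (2 * Rabs u + 2 * Rabs v) 1) as [N3 K3]; [lra|].
  set (N := (N1 + N2 + N3)%nat).
  specialize (K1 N ltac:(lia)); specialize (K2 N ltac:(lia)); specialize (K3 N ltac:(lia)).
  pose proof (INR_S_pos N) as HN0; pose proof (Rabs_pos u); pose proof (Rabs_pos v).
  set (X := (INR (S N) + / 2) * PI).
  assert (HX : INR (S N) <= X) by (unfold X; nra).
  apply Rlt_div_l in K3; [|exact HN0].
  pose proof (residue_sum_bound G B u v HG HB (fun E => Hvu (eq_sym E)) Hu Hv N X eq_refl
                ltac:(lra) ltac:(lra)) as HR.
  assert (HX2 : 64 * B / X <= 64 * B * / INR (S N)).
  { unfold Rdiv; apply Rmult_le_compat_l; [lra|]; apply Rinv_le_contravar; lra. }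
  pose proof (Zstar_sum_bound _ _ N N (residue_difference_bound v Hv1)) as HD.
  rewrite Zstar_sum_minus in HD; specialize (HS N N).
  match goal with |- Cmod (?a + S0) <= _ =>
    replace (a + S0)%C with
      ((a + Zstar_sum (integer_residue G u v) N N)
       + (- (Zstar_sum (integer_residue G u v) N N - Zstar_sum limit_residue N N)
          + - (Zstar_sum limit_residue N N - S0)))%C by ring end.
  eapply Rle_trans; [apply Cmod_triangle|].
  eapply Rle_trans; [apply Rplus_le_compat_l, Cmod_triangle|]; rewrite !Cmod_opp; lra.
Qed.

(* The double pole at 0 is obtained as the confluence of the simple poles at
   [v] and 0; the residues there have a limit since G and sinc are
   differentiable at 0. *)
Lemma sampling_formula (S0 : C) (A : R) :
  (forall m n, Cmod (Zstar_sum limit_residue m n - S0) <= A * / INR (S m) + A * / INR (S n)) ->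
  G u = (RtoC (sin u) * G1 + RtoC (sin u / u) * G 0 - RtoC u * (RtoC (sin u) * S0))%C.
Proof.
  intros HS.
  assert (Hu0 : u <> 0) by (intros ->; apply Hu, sin_0).
  assert (HuC : RtoC u <> 0%C) by (intros E; apply RtoC_inj in E; contradiction).
  assert (HsC : RtoC (sin u) <> 0%C) by (intros E; apply RtoC_inj in E; contradiction).
  destruct HG1 as (g & Hg & Hgl & Hge).
  destruct cderiv_csinc_0 as (p & Hp & Hpl & Hpe).
  (* The residues at u, v and 0 with the singularity at v = 0 cancelled. Insert G v = G 0 + v g(v)
     and sin v = v sinc v; the terms with G 0 / v combine through u + (v - u) sinc v = v (1 + (v -
     u) p(v)), where sinc v = 1 + v p(v). At v = 0 one has g = G1, p = 0 and sinc = 1. *)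
  pose (Psi := fun w => (G u / ((u - w) * sin u) + g w / ((w - u) * csinc w)
                 + G 0 * (1 + (w - u) * p w) / (u * ((w - u) * csinc w)))%C).
  assert (Hq : ccont csinc 0) by exact (cderiv_ccont _ _ _ cderiv_csinc_0).
  assert (Hwu : ccont (fun w => w - u)%C 0)
    by (apply ccont_minus; [apply ccont_id|apply ccont_const]).
  assert (H0u : (0 - RtoC u)%C <> 0%C) by (apply Cminus_neq_0; auto).
  assert (Hu00 : (RtoC u - 0)%C <> 0%C) by now apply Cminus_neq_0.
  assert (Hden : ((0 - u) * csinc 0)%C <> 0%C).
  { rewrite csinc_0; apply Cmult_neq_0; [exact H0u|]; intros E; apply RtoC_inj in E; lra. }
  assert (HPsi : ccont Psi 0).
  { unfold Psi; apply ccont_plus; [apply ccont_plus|]; apply ccont_div.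
    - apply ccont_const.
    - apply ccont_mult; [apply ccont_minus|]; try apply ccont_const; apply ccont_id.
    - now apply Cmult_neq_0.
    - exact Hg.
    - now apply ccont_mult.
    - exact Hden.
    - apply ccont_mult; [apply ccont_const|]; apply ccont_plus; [apply ccont_const|].
      now apply ccont_mult.
    - apply ccont_mult; [apply ccont_const|]; now apply ccont_mult.
    - now apply Cmult_neq_0. }
  assert (HPsi0 : Psi 0 = (G u / (u * sin u) - G1 / u - G 0 / (u * u))%C).
  { unfold Psi; rewrite Hgl, Hpl, csinc_0; field; auto. }
  assert (Hnz : @locally C_UniformSpace (RtoC 0) (fun w => csinc w <> 0%C)).
  { apply ccont_nonzero; [exact Hq|]; rewrite csinc_0; intros E; apply RtoC_inj in E; lra. }
  assert (Hloc : @locally C_UniformSpace (RtoC 0) (fun w => (w - u)%C <> 0%C))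
    by now apply ccont_nonzero.
  destruct (proj1 (locally_Cmod _ _) (filter_and _ _ (filter_and _ _ Hge Hpe)
              (filter_and _ _ Hnz Hloc))) as [d0 [Hd0 K0]].
  assert (Hzero : (Psi 0 + S0)%C = 0%C).
  { apply Cmod_eq_0, Rle_antisym; [|apply Cmod_ge_0].
    apply le_epsilon; intros eps He; rewrite Rplus_0_l.
    destruct (proj1 (ccontE _ _) HPsi (eps / 2)) as [d1 [Hd1 K1]]; [lra|].
    set (D := 4 * (B / Rabs (sin u))).
    assert (HD : 0 <= D).
    { assert (0 < Rabs (sin u)) by now apply Rabs_pos_lt.
      pose proof (bound_on_reals 0); pose proof (Cmod_ge_0 (G (RtoC 0))).
      unfold D; apply Rmult_le_pos; [lra|]; apply Rdiv_le_0_compat; lra. }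
    (* A positive v < 1 has sin v <> 0. Using D + 1 instead of D avoids dividing by 0. *)
    assert (Hex : exists v, 0 < v /\ v < d0 /\ v < d1 /\ v < 1 /\ (D + 1) * v <= eps / 2).
    { assert (0 < eps / (2 * (D + 1))) by (apply Rdiv_lt_0_compat; lra).
      exists (Rmin (Rmin (d0 / 2) (d1 / 2)) (Rmin (/ 2) (eps / (2 * (D + 1))))).
      set (v := Rmin _ _).
      assert (Hv : 0 < v /\ v < d0 /\ v < d1 /\ v < 1 /\ v <= eps / (2 * (D + 1)))
        by (unfold v, Rmin; repeat destruct Rle_dec; lra).
      destruct Hv as (V1 & V2 & V3 & V4 & V5); repeat split; try assumption.
      apply Rmult_le_compat_l with (r := D + 1) in V5; [|lra].
      replace ((D + 1) * (eps / (2 * (D + 1)))) with (eps / 2) in V5 by (field; lra); exact V5. }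
    destruct Hex as (v & V1 & V2 & V3 & V4 & V5).
    assert (Hva : Rabs v = v) by (apply Rabs_pos_eq; lra).
    assert (Hvm : Cmod (RtoC v - 0) = v).
    { replace (RtoC v - 0)%C with (RtoC v) by ring; rewrite Cmod_R; exact Hva. }
    destruct (K0 v ltac:(lra)) as [[E1 E2] [E3 E4]].
    specialize (K1 v ltac:(lra)).
    assert (Hsv : sin v <> 0).
    { apply Rgt_not_eq, sin_gt_0; [lra|]; pose proof PI2_1; unfold PI2 in *; lra. }
    assert (Hvu : v <> u) by (intros E; apply E4; rewrite E; ring).
    assert (HvC : RtoC v <> 0%C) by (intros E; apply RtoC_inj in E; lra).
    pose proof (limit_residue_near S0 A v HS Hvu Hsv ltac:(lra)) as HR.
    fold D in HR; rewrite Hva in HR.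
    assert (Huv : (RtoC u - RtoC v)%C <> 0%C)
      by (apply Cminus_neq_0; intros E; apply Hvu; symmetry; now apply RtoC_inj).
    match type of HR with Cmod (?a + S0) <= _ => assert (EPsi : a = Psi v) end.
    { unfold Psi, integer_residue, altsign; rewrite csin_R, (csin_csinc v), E1.
      rewrite Rmult_0_l; simpl powerRZ.
      assert (Eq : (u + (v - u) * csinc v)%C = (v * (1 + (v - u) * p v))%C).
      { rewrite E2 at 1; rewrite csinc_0; ring. }
      replace (1 + (v - u) * p v)%C with ((u + (v - u) * csinc v) / v)%C
        by (rewrite Eq; field; exact HvC).
      field; repeat split; assumption. }
    rewrite EPsi in HR.
    replace (Psi 0 + S0)%C with (- (Psi v - Psi 0) + (Psi v + S0))%C by ring.
    eapply Rle_trans; [apply Cmod_triangle|]; rewrite Cmod_opp; nra. }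
  rewrite HPsi0 in Hzero.
  assert (ES : S0 = (- (G u / (u * sin u) - G1 / u - G 0 / (u * u)))%C).
  { replace S0 with (G u / (u * sin u) - G1 / u - G 0 / (u * u) + S0
                     - (G u / (u * sin u) - G1 / u - G 0 / (u * u)))%C by ring.
    rewrite Hzero; ring. }
  rewrite ES, RtoC_div by assumption; field; auto.
Qed.

End Sampling.

(** * The Mellin setting *)

(** Since polar (exp x) y = cexp (x, y), the difference quotient in logarithmic coordinates is the
    polar one times that of [cexp]. The latter tends to cexp z <> 0, so cexp w differs from cexp z
    for w <> z near z. *)
Lemma is_Dpol_cderiv (f : R -> R -> C) (z l : C) :
  is_Dpol f (exp (fst z)) (snd z) l ->
  cderiv (fun w => f (exp (fst w)) (snd w)) z (l * cexp z)%C.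
Proof.
  intros H; set (phi := fun w : C => f (exp (fst w)) (snd w)).
  destruct (cderiv_cexp z) as (e & He & Hel & Hee).
  pose (psi := fun w => if Ceq_dec w z then l else ((phi w - phi z) / (cexp w - cexp z))%C).
  assert (Hpz : psi z = l) by (unfold psi; destruct (Ceq_dec z z); [reflexivity|contradiction]).
  exists (fun w => psi w * e w)%C; split; [|split; [congruence|]].
  - apply ccont_mult; [|exact He].
    apply ccontE; intros eps Heps; rewrite Hpz.
    destruct (H (fun v => Cmod (v - l) < eps)) as [d Hd].
    { apply locally_Cmod; exists eps; auto. }
    assert (Hexp : continuity_pt exp (fst z)) by apply derivable_continuous_pt, derivable_pt_exp.
    destruct (Hexp d (cond_pos d)) as [d1 [Hd1 K1]].
    exists (Rmin d d1); split; [apply Rmin_pos; [apply cond_pos|exact Hd1]|].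
    intros w Hw; unfold psi; destruct (Ceq_dec w z) as [->|Hn].
    { replace (l - l)%C with (RtoC 0) by ring; rewrite Cmod_0; exact Heps. }
    pose proof (Rmin_l d d1); pose proof (Rmin_r d d1).
    assert (M1 : Rabs (fst w - fst z) <= Cmod (w - z))
      by (eapply Rle_trans; [|apply Rmax_Cmod]; apply Rmax_l).
    assert (M2 : Rabs (snd w - snd z) <= Cmod (w - z))
      by (eapply Rle_trans; [|apply Rmax_Cmod]; apply Rmax_r).
    apply (Hd (exp (fst w), snd w)).
    + split.
      * destruct (Req_dec (fst w) (fst z)) as [E|Hne].
        -- simpl; rewrite E; apply ball_center.
        -- apply K1; split; [split; [exact I|auto]|].
           change (Rabs (fst w - fst z) < d1); lra.
      * change (Rabs (snd w - snd z) < d); lra.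
    (* Injectivity of the real exponential keeps the point inside the punctured neighbourhood. *)
    + intros E; injection E; intros E2 E1; apply Hn.
      apply injective_projections; [now apply exp_inv|exact E2].
  - assert (Hez : e z <> 0%C) by (rewrite Hel; apply cexp_neq_0).
    generalize (filter_and _ _ Hee (ccont_nonzero e z He Hez)); apply filter_imp.
    intros w [E1 E2]; change (phi w = phi z + psi w * e w * (w - z))%C.
    unfold psi; destruct (Ceq_dec w z) as [->|Hn]; [ring|].
    rewrite E1; field.
    replace (cexp z + e w * (w - z) - cexp z)%C with (e w * (w - z))%C by ring.
    apply Cmult_neq_0; [exact E2|now apply Cminus_neq_0].
Qed.

Lemma Dpol_correct (f : R -> R -> C) (r t : R) :
  0 < r -> polar_analytic f -> is_Dpol f r t (Dpol f r t).
Proof.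
  intros Hr Hf; destruct (Hf r t Hr) as [l Hl].
  assert (HF : ProperFilter'
    (locally' ((r, t) : prod_UniformSpace R_UniformSpace R_UniformSpace))).
  { constructor; [|apply locally'_filter].
    (* This point witnesses that punctured neighbourhoods are nonempty; the limit is then unique and
       [iota] returns it. *)
    intros [d Hd]; apply (Hd (r + d / 2, t)).
    - pose proof (cond_pos d); split; [|apply ball_center].
      change (Rabs (r + d / 2 - r) < d); replace (r + d / 2 - r) with (d / 2) by ring.
      rewrite Rabs_pos_eq; lra.
    - intros E; injection E; pose proof (cond_pos d); lra. }
  assert (E : Dpol f r t = l); [|rewrite E; exact Hl].
  exact (@iota_filterlim_locally _ C_CompleteNormedModule _ _ HF _ l Hl).
Qed.

Lemma cexp_R (x : R) : cexp (RtoC x) = RtoC (exp x).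
Proof. unfold cexp, RtoC; simpl; rewrite cos_0, sin_0; f_equal; ring. Qed.

(* r^c e^{i c theta} f(r, theta) in the variable z = T (log r + i theta). *)
Definition log_lift (c T : R) (f : R -> R -> C) (z : C) : C :=
  (cexp (RtoC (c / T) * z) * f (exp (fst z / T)) (snd z / T)%R)%C.

Lemma cderiv_log_lift (c T : R) (f : R -> R -> C) (z : C) : 0 < T -> polar_analytic f ->
  cderiv (log_lift c T f) z
    (cexp (RtoC (c / T) * z) * (RtoC (c / T) * f (exp (fst z / T)) (snd z / T)%R
       + Dpol f (exp (fst z / T)) (snd z / T)%R * cexp ((fst z / T)%R, (snd z / T)%R) / T))%C.
Proof.
  intros HT Hf.
  assert (Hsc : forall w : C, (RtoC (/ T) * w)%C = (fst w / T, snd w / T)).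
  { intros w; apply injective_projections; simpl; field; lra. }
  set (x := fst z / T); set (y := snd z / T).
  assert (Hphi : cderiv (fun w => f (exp (fst w)) (snd w)) (RtoC (/ T) * z)%C
                   (Dpol f (exp x) y * cexp (RtoC (/ T) * z))%C).
  { apply is_Dpol_cderiv; rewrite Hsc; apply Dpol_correct; [apply exp_pos|exact Hf]. }
  assert (Hlin : forall k : C, cderiv (fun w => k * w)%C z (0 * z + k * 1)%C).
  { intros k; apply cderiv_mult; [apply cderiv_const|apply cderiv_id]. }
  apply (cderiv_ext_loc (fun w => cexp (RtoC (c / T) * w)
           * f (exp (fst (RtoC (/ T) * w)%C)) (snd (RtoC (/ T) * w)%C))%C).
  { apply locally_Cmod; exists 1; split; [lra|]; intros w _; rewrite Hsc; reflexivity. }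
  pose proof (cderiv_mult _ _ _ _ _
    (cderiv_comp cexp (fun w => RtoC (c / T) * w)%C z _ _ (cderiv_cexp _) (Hlin _))
    (cderiv_comp _ (fun w => RtoC (/ T) * w)%C z _ _ Hphi (Hlin _))) as H.
  cbv beta in H; match type of H with cderiv _ _ ?l => match goal with |- cderiv _ _ ?m =>
    replace m with l; [exact H|] end end.
  rewrite Hsc; cbn [fst snd]; fold x y; rewrite (RtoC_inv T) by lra; unfold Cdiv; ring.
Qed.

Lemma cderiv_log_lift_0 (c T : R) (f : R -> R -> C) : 0 < T -> polar_analytic f ->
  cderiv (log_lift c T f) 0 (Mellin_Theta c f 1 0 / RtoC T)%C.
Proof.
  intros HT Hf; pose proof (cderiv_log_lift c T f 0 HT Hf) as H; cbn [fst snd RtoC] in H.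
  replace (Mellin_Theta c f 1 0 / RtoC T)%C with
    (cexp (RtoC (c / T) * 0) * (RtoC (c / T) * f (exp (0 / T)) (0 / T)%R
       + Dpol f (exp (0 / T)) (0 / T)%R * cexp ((0 / T)%R, (0 / T)%R) / T))%C; [exact H|].
  assert (HTC : RtoC T <> 0%C) by (intros E; apply RtoC_inj in E; lra).
  replace (0 / T) with 0 by (field; lra); rewrite exp_0.
  replace (RtoC (c / T) * 0)%C with (RtoC 0) by ring.
  change (cexp (0, 0)) with (cexp 0); rewrite cexp_0, RtoC_div by lra.
  unfold Mellin_Theta, polar; rewrite cos_0, sin_0, Rmult_0_r, Rmult_1_r.
  change (1, 0) with (RtoC 1); field; exact HTC.
Qed.

(** The exponential factor has modulus r^c at r = exp (x / T), and scaling by T normalizes the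
    exponential type to 1. *)
Lemma log_lift_bound (c T Cf : R) (f : R -> R -> C) (x y : R) : 0 < T ->
  (forall r t, 0 < r -> Rpower r c * Cmod (f r t) <= Cf * exp (T * Rabs t)) ->
  Cmod (log_lift c T f (x, y)) <= Cf * exp (Rabs y).
Proof.
  intros HT H; unfold log_lift; rewrite Cmod_mult, Cmod_cexp; simpl.
  specialize (H (exp (x / T)) (y / T) (exp_pos _)).
  unfold Rpower in H; rewrite ln_exp in H.
  replace (c / T * x - 0 * y) with (c * (x / T)) by (field; lra).
  replace (Rabs y) with (T * Rabs (y / T)); [exact H|].
  unfold Rdiv; rewrite Rabs_mult, (Rabs_pos_eq (/ T))
    by (apply Rlt_le, Rinv_0_lt_compat; exact HT); field; lra.
Qed.

Lemma log_lift_R (c T : R) (f : R -> R -> C) (x : R) :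
  log_lift c T f (RtoC x) = (RtoC (exp (c * x / T)) * f (exp (x / T)) 0)%C.
Proof.
  unfold log_lift; rewrite <- RtoC_mult, cexp_R; simpl.
  replace (0 / T) with 0 by (unfold Rdiv; ring); do 3 f_equal; unfold Rdiv; ring.
Qed.

(** * Continuous extensions and the cardinal series *)

Definition rsinc (h : R) : R := if Req_EM_T h 0 then 1 else sin h / h.

Lemma rsinc_bounds (h : R) : Rabs (rsinc h) <= 1 /\ Rabs h * Rabs (rsinc h) <= 1.
Proof.
  unfold rsinc; destruct (Req_EM_T h 0) as [->|Hh].
  - rewrite Rabs_R0, Rabs_R1; lra.
  - rewrite Rabs_div by exact Hh; assert (H0 : 0 < Rabs h) by now apply Rabs_pos_lt.
    split; [apply Rle_div_l; [exact H0|]; rewrite Rmult_1_l; apply abs_sin_le|].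
    replace (Rabs h * (Rabs (sin h) / Rabs h)) with (Rabs (sin h)) by (field; lra).
    apply Rabs_le, SIN_bound.
Qed.

Lemma is_lim_rsinc (T a r : R) : 0 < T -> 0 < r ->
  is_lim (fun x => sin (T * ln x - a) / (T * ln x - a)) r (rsinc (T * ln r - a)).
Proof.
  intros HT Hr.
  assert (Hd : is_derive (fun x => T * ln x - a) r (T / r)).
  { auto_derive; [exact Hr|field; lra]. }
  assert (Hc : continuity_pt (fun x => T * ln x - a) r).
  { apply continuity_pt_filterlim.
    apply (ex_derive_continuous (K := R_AbsRing) (V := R_NormedModule)
             (fun x => T * ln x - a) r); now exists (T / r). }
  unfold rsinc; destruct (Req_EM_T (T * ln r - a) 0) as [E|Hne].
  - apply (is_lim_comp (fun h => sin h / h) (fun x => T * ln x - a) r 1 0).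
    + exact is_lim_sinc_0.
    + rewrite <- E; exact (is_lim_continuity _ r Hc).
    (* The limit at 0 of sin h / h excludes h = 0; injectivity of [ln] on positive numbers excludes
       it for x <> r. *)
    + exists (mkposreal r Hr); intros x Hx Hxr Ex; apply Hxr.
      assert (Hx0 : 0 < x).
      { change (Rabs (x - r) < r) in Hx; apply Rabs_def2 in Hx; lra. }
      injection Ex; intros Ex'; apply ln_inv; [exact Hx0|exact Hr|].
      apply Rmult_eq_reg_l with T; lra.
  - refine (is_lim_continuity (fun x => sin (T * ln x - a) / (T * ln x - a)) r _).
    apply (continuity_pt_div (fun x => sin (T * ln x - a)) _ r); [|exact Hc|exact Hne].
    apply (continuity_pt_comp (fun x => T * ln x - a) sin); [exact Hc|].
    apply derivable_continuous_pt, derivable_pt_sin.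
Qed.

Lemma cont_ext_lim (q : R -> R) (x l : R) : is_lim q x l -> cont_ext q x = l.
Proof. intros H; unfold cont_ext; now rewrite (is_lim_unique q x l H). Qed.

(** Shifting the argument of the sine by k PI moves the singular point to the origin of sinc, at the
    price of (-1)^k; the minus sign comes from the reversed denominator. *)
Lemma cont_ext_sin_quotient (T r : R) (k : Z) : 0 < T -> 0 < r ->
  cont_ext (fun x => sin (T * ln x) / (IZR k * PI - T * ln x)) r =
  - altsign k * rsinc (T * ln r - IZR k * PI).
Proof.
  intros HT Hr; apply cont_ext_lim.
  apply (is_lim_ext (fun x => - altsign k *
    (sin (T * ln x - IZR k * PI) / (T * ln x - IZR k * PI)))).
  - intros x; replace (sin (T * ln x)) with (altsign k * sin (T * ln x - IZR k * PI)).
    + replace (IZR k * PI - T * ln x) with (- (T * ln x - IZR k * PI)) by ring.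
      unfold Rdiv; rewrite Rinv_opp; ring.
    + rewrite <- (proj1 (trig_plus_kPI _ k)); f_equal; ring.
  - exact (is_lim_scal_l _ (- altsign k) r _ (is_lim_rsinc T (IZR k * PI) r HT Hr)).
Qed.

Lemma cont_ext_sinc (T r : R) : 0 < T -> 0 < r ->
  cont_ext (fun x => sin (T * ln x) / (T * ln x)) r = rsinc (T * ln r).
Proof.
  intros HT Hr; apply cont_ext_lim.
  apply (is_lim_ext (fun x => sin (T * ln x - 0) / (T * ln x - 0))).
  - intros x; now rewrite Rminus_0_r.
  - rewrite <- (Rminus_0_r (T * ln r)); now apply is_lim_rsinc.
Qed.

(** The sampling term after (-1)^{k+1} has cancelled against -(-1)^k: the term with index k of the
    classical cardinal series of G(z) / z. *)
Definition cardinal_term (G : C -> C) (u : R) (k : Z) : C :=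
  (G (RtoC (IZR k * PI)) / RtoC (IZR k * PI) * RtoC (rsinc (u - IZR k * PI)))%C.

Lemma sampling_term_cardinal (c T : R) (f : R -> R -> C) (r : R) : 0 < T -> 0 < r ->
  sampling_term c T f r = cardinal_term (log_lift c T f) (T * ln r).
Proof.
  intros HT Hr; apply functional_extensionality; intros k.
  unfold sampling_term, cardinal_term.
  rewrite cont_ext_sin_quotient, log_lift_R by assumption.
  replace (c * (IZR k * PI) / T) with (IZR k * PI * c / T) by (unfold Rdiv; ring).
  change (powerRZ (-1) (k + 1)) with (altsign (Z.succ k)); rewrite altsign_succ.
  rewrite !RtoC_mult, RtoC_opp.
  assert (Hs : (RtoC (altsign k) * RtoC (altsign k))%C = 1%C)
    by (rewrite <- RtoC_mult, altsign_sqr; reflexivity).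
  unfold Cdiv.
  match goal with |- (- ?s * ?e * ?F * ?i * (- ?s * ?q))%C = ?rhs =>
    transitivity (s * s * (e * F * i * q))%C; [ring|rewrite Hs; ring] end.
Qed.

(** One factor 1 / |k| comes from the denominator k PI, the other from sinc: with h = u - k PI, |k|
    <= |h| + |u|, while |h sinc h| and |sinc h| are at most 1. *)
Lemma cardinal_term_bounded (G : C -> C) (B u U : R) :
  (forall x, Cmod (G (RtoC x)) <= B) -> Rabs u <= U ->
  inv_square_bounded (cardinal_term G u) (B * (1 + U)).
Proof.
  intros HB HU k Hk; unfold cardinal_term.
  assert (HPI : 2 < PI) by (pose proof PI2_1; unfold PI2 in *; lra).
  pose proof (abs_IZR_ge_1 k Hk) as Hk1.
  assert (Hkp : Rabs (IZR k) <= Rabs (IZR k * PI)).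
  { rewrite Rabs_mult, (Rabs_pos_eq PI) by lra; nra. }
  set (h := u - IZR k * PI); destruct (rsinc_bounds h) as [R1 R2].
  assert (Hr : Rabs (IZR k) * Rabs (rsinc h) <= 1 + U).
  { assert (Ht : Rabs (IZR k * PI) <= Rabs h + Rabs u).
    { replace (IZR k * PI) with (- h + u) by (unfold h; ring).
      eapply Rle_trans; [apply Rabs_triang|]; rewrite Rabs_Ropp; lra. }
    pose proof (Rabs_pos (rsinc h)); pose proof (Rabs_pos u); nra. }
  assert (Np : RtoC (IZR k * PI) <> 0%C) by (apply Cmod_gt_0; rewrite Cmod_R; lra).
  rewrite Cmod_mult, Cmod_div, !Cmod_R by exact Np.
  replace (IZR k ^ 2) with (Rabs (IZR k) * Rabs (IZR k))
    by (rewrite <- Rabs_mult, Rabs_pos_eq; [ring|nra]).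
  pose proof (HB (IZR k * PI)) as HBk; pose proof (Cmod_ge_0 (G (RtoC (IZR k * PI)))).
  replace (B * (1 + U) * / (Rabs (IZR k) * Rabs (IZR k))) with
    (B / Rabs (IZR k) * ((1 + U) / Rabs (IZR k))) by (field; lra).
  apply Rmult_le_compat; try apply Rabs_pos.
  - apply Rdiv_le_0_compat; lra.
  - unfold Rdiv; apply Rmult_le_compat; try lra.
    + apply Rlt_le, Rinv_0_lt_compat; lra.
    + apply Rinv_le_contravar; lra.
  - apply Rle_div_r; [lra|]; rewrite Rmult_comm; exact Hr.
Qed.

Lemma Zstar_series_rate (t : Z -> C) (A : R) (m n : nat) : inv_square_bounded t A ->
  Cmod (Zstar_sum t m n - Zstar_series t) <= A * / INR (S m) + A * / INR (S n).
Proof.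
  intros H; destruct (Zstar_sum_limit t A H) as [s Hs].
  rewrite (Zstar_series_limit t s A Hs); apply Hs.
Qed.

Lemma Zstar_sum_scal (s t : Z -> C) (a : C) (m n : nat) :
  (forall k, k <> 0%Z -> s k = (a * t k)%C) -> Zstar_sum s m n = (a * Zstar_sum t m n)%C.
Proof.
  intros H.
  assert (Hs : forall (p q : nat -> C) i, (forall j, p j = (a * q j)%C) ->
    @eq C (sum_n p i) (a * sum_n q i)%C).
  { intros p q i Hpq; induction i as [|i IH]; [now rewrite !sum_O|].
    rewrite !sum_Sn, IH, Hpq; change (@plus C_AbelianMonoid) with Cplus; ring. }
  unfold Zstar_sum.
  rewrite (Hs (fun j => s (- Z.of_nat (S j))%Z) (fun j => t (- Z.of_nat (S j))%Z))
    by (intros j; apply H; lia).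
  rewrite (Hs (fun j => s (Z.of_nat (S j))) (fun j => t (Z.of_nat (S j))))
    by (intros j; apply H; lia); ring.
Qed.

Lemma cardinal_series (G : C -> C) (B u : R) (G1 : C) :
  (forall z, exists l, cderiv G z l) -> cderiv G 0 G1 ->
  (forall x y, Cmod (G (x, y)) <= B * exp (Rabs y)) ->
  G u = (RtoC (sin u) * G1 + RtoC (rsinc u) * G 0
         + RtoC u * Zstar_series (cardinal_term G u))%C.
Proof.
  intros HG HG1 HB; destruct (Req_dec (sin u) 0) as [Hs|Hs].
  (* The contour argument needs sin u <> 0. At u = 0 the identity reads G 0 = G 0; at u = j PI with
     j <> 0 only the term k = j remains, and the factor u cancels its denominator. *)
  - rewrite Hs; apply sin_eq_0_0 in Hs; destruct Hs as [j ->].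
    destruct (Z.eq_dec j 0) as [->|Hj].
    + rewrite Rmult_0_l; unfold rsinc; destruct (Req_EM_T 0 0) as [_|n]; [ring|now elim n].
    + assert (Hjp : forall i, i <> 0%Z -> IZR i * PI <> 0).
      { intros i Hi; apply Rmult_integral_contrapositive; split; [|apply PI_neq0].
        intros E; apply Hi; now apply eq_IZR. }
      assert (Hz : forall i, i <> 0%Z -> rsinc (IZR i * PI) = 0).
      { intros i Hi; unfold rsinc; destruct (Req_EM_T (IZR i * PI) 0) as [E|_].
        - now elim (Hjp i Hi).
        - rewrite sin_kPI; unfold Rdiv; ring. }
      rewrite (Zstar_series_single _ j Hj), (Hz j Hj).
      * unfold cardinal_term; replace (IZR j * PI - IZR j * PI) with 0 by ring.
        unfold rsinc; destruct (Req_EM_T 0 0) as [_|n]; [|now elim n].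
        field; intros E; apply (Hjp j Hj); now apply RtoC_inj.
      * intros k Hk; unfold cardinal_term.
        replace (IZR j * PI - IZR k * PI) with (IZR (j - k) * PI) by (rewrite minus_IZR; ring).
        rewrite Hz by lia; ring.
  - assert (HsC : RtoC (sin u) <> 0%C) by (intros E; apply RtoC_inj in E; contradiction).
    assert (Hu0 : u <> 0) by (intros ->; apply Hs, sin_0).
    set (A := B * (1 + Rabs u)).
    assert (HbA : inv_square_bounded (cardinal_term G u) A).
    { apply cardinal_term_bounded; [apply bound_on_reals; exact HB|apply Rle_refl]. }
    (* From sin (u - k PI) = (-1)^k sin u, each [limit_residue] is -1 / sin u times the cardinal
       term, so sums and rates are scaled by this factor. *)
    rewrite (sampling_formula G B u G1 HG HG1 HB Hs
               (- / RtoC (sin u) * Zstar_series (cardinal_term G u))%C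
               (Cmod (- / RtoC (sin u)) * A)).
    + unfold rsinc; destruct (Req_EM_T u 0) as [E|_]; [contradiction|]; field; exact HsC.
    + intros m n; rewrite (Zstar_sum_scal _ (cardinal_term G u) (- / RtoC (sin u))%C).
      * match goal with |- Cmod (?a * ?s - ?a * ?l) <= _ =>
          replace (a * s - a * l)%C with (a * (s - l))%C by ring end.
        rewrite Cmod_mult, !Rmult_assoc, <- Rmult_plus_distr_l.
        apply Rmult_le_compat_l; [apply Cmod_ge_0|now apply Zstar_series_rate].
      * intros k Hk; unfold limit_residue, cardinal_term, rsinc.
        assert (Nk : u - IZR k * PI <> 0).
        { intros E; apply Hs; replace u with (IZR k * PI) by lra; apply sin_kPI. }
        destruct (Req_EM_T (u - IZR k * PI) 0) as [E|_]; [contradiction|].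
        replace (sin (u - IZR k * PI)) with (altsign k * sin u).
        2:{ replace (sin u) with (sin (u - IZR k * PI + IZR k * PI)) by (f_equal; ring).
            rewrite (proj1 (trig_plus_kPI _ k)), <- Rmult_assoc, altsign_sqr; ring. }
        rewrite RtoC_div, (RtoC_mult (altsign k)), RtoC_minus by exact Nk.
        assert (NkC : (RtoC u - RtoC (IZR k * PI))%C <> 0%C).
        { rewrite <- RtoC_minus; intros E; apply RtoC_inj in E; contradiction. }
        assert (NkC' : (RtoC (IZR k * PI) - RtoC u)%C <> 0%C).
        { intros E; apply NkC; rewrite <- Copp_minus_distr, E; ring. }
        assert (Np : RtoC (IZR k * PI) <> 0%C).
        { intros E; apply RtoC_inj in E; apply Rmult_integral in E.
          destruct E as [E|E]; [apply Hk; now apply eq_IZR|now apply PI_neq0]. }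
        field; auto.
Qed.

(** A compact set is bounded above, and being closed without containing 0 it keeps a positive
    distance [d] from 0. *)
Lemma compact_positive_ln_bounded (K : R -> Prop) :
  compact K -> (forall r, K r -> 0 < r) -> exists U, forall r, K r -> Rabs (ln r) <= U.
Proof.
  intros HK Hpos; destruct (compact_P1 K HK) as (m & M & HM).
  destruct (compact_P2 K HK 0) as [d Hd].
  { intros H0; specialize (Hpos 0 H0); lra. }
  exists (Rabs (ln d) + Rabs (ln M)); intros r Hr.
  pose proof (cond_pos d); pose proof (Hpos r Hr); destruct (HM r Hr) as [_ HrM].
  assert (Hdr : d <= r).
  { apply Rnot_lt_le; intros Hlt; apply (Hd r); [|exact Hr].
    unfold disc; rewrite Rminus_0_r, Rabs_pos_eq; lra. }
  pose proof (ln_le d r ltac:(lra) Hdr); pose proof (ln_le r M ltac:(lra) HrM).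
  pose proof (Rle_abs (ln M)); pose proof (Rle_abs (- ln d)) as H4; rewrite Rabs_Ropp in H4.
  pose proof (Rabs_pos (ln d)); pose proof (Rabs_pos (ln M)); apply Rabs_le; lra.
Qed.

Theorem theorem7 (c T : R) (f : R -> R -> C)
    (hT : 0 < T) (hf : Mellin_Bernstein c T f) :
  (forall r : R, 0 < r ->
     (RtoC (Rpower r c) * f r 0 =
      RtoC (sin (T * ln r)) * (Mellin_Theta c f 1 0 / RtoC T)
      + RtoC (cont_ext (fun x => (sin (T * ln x) / (T * ln x))%R) r) * f 1 0
      + RtoC (T * ln r) * Zstar_series (sampling_term c T f r))%C) /\
  (forall r : R, 0 < r -> Zstar_abs_convergent (sampling_term c T f r)) /\
  (forall K : R -> Prop, compact K -> (forall r : R, K r -> 0 < r) ->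
     Zstar_converges_uniformly_on K (sampling_term c T f)
       (fun r => Zstar_series (sampling_term c T f r))).
Proof.
  destruct hf as (Hf & _ & Cf & HCf & Hbound).
  set (G := log_lift c T f).
  assert (HG : forall z, exists l, cderiv G z l)
    by (intros z; eexists; now apply cderiv_log_lift).
  assert (HB : forall x y, Cmod (G (x, y)) <= Cf * exp (Rabs y))
    by (intros x y; now apply log_lift_bound).
  assert (HR : forall x, Cmod (G (RtoC x)) <= Cf) by now apply bound_on_reals.
  split; [|split].
  - intros r Hr; rewrite sampling_term_cardinal, cont_ext_sinc by assumption; fold G.
    pose proof (cardinal_series G Cf (T * ln r) _ HG (cderiv_log_lift_0 c T f hT Hf) HB) as H.
    assert (HGR : forall x, G (RtoC x) = (RtoC (exp (c * x / T)) * f (exp (x / T)) 0)%C)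
      by apply log_lift_R.
    rewrite !HGR in H.
    replace (c * (T * ln r) / T) with (c * ln r) in H by (field; lra).
    replace (T * ln r / T) with (ln r) in H by (field; lra).
    rewrite exp_ln in H by exact Hr.
    replace (c * 0 / T) with 0 in H by (field; lra).
    replace (0 / T) with 0 in H by (field; lra); rewrite exp_0 in H.
    unfold Rpower; rewrite H; ring.
  - intros r Hr; rewrite sampling_term_cardinal by assumption.
    apply (Zstar_abs_convergent_inv_square _ (Cf * (1 + Rabs (T * ln r)))).
    + pose proof (Rabs_pos (T * ln r)); nra.
    + apply cardinal_term_bounded; [exact HR|apply Rle_refl].
  - intros K HK Hpos eps; destruct (compact_positive_ln_bounded K HK Hpos) as [U HU].
    (* This constant bounds the terms for every r in K at once, so the rate is uniform; each of the
       two tails receives eps / 2. *)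
    destruct (inv_INR_small (Cf * (1 + T * U)) (eps / 2)) as [N HN].
    { pose proof (cond_pos eps); lra. }
    exists N; intros m n Hm Hn r Hr.
    rewrite sampling_term_cardinal by auto.
    eapply Rle_lt_trans.
    + apply Zstar_series_rate, (cardinal_term_bounded G Cf (T * ln r) (T * U)); [exact HR|].
      rewrite Rabs_mult, (Rabs_pos_eq T) by lra.
      apply Rmult_le_compat_l; [lra|now apply HU].
    + pose proof (HN m Hm); pose proof (HN n Hn); lra.
Qed.
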